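(* Let $k$, $\mathcal{O}$, $\iota_1,\iota_2$, $I$, $\xi$, $\mathfrak{f}\neq\mathcal{O}$, $f$, $\mu_f$, $\tau_1,\tau_2$ be as in the context, and let $p$ be a prime number with $(p,\mathfrak{f})=1$ (i.e. no prime ideal above $p$ divides $\mathfrak f$). Then: (1) the series $z_{T_p}(s;\xi,I,\tau_1,\tau_2)$ converges absolutely for $\Re(s)>1$ and possesses a meromorphic continuation to $\mathbb{C}$; (2) for each $m\in\mathbb{Z}_{\le 0}$ this continuation is analytic at $s=m$ and, for either ordered pair $\underline\iota\in\{(\iota_1,\iota_2),(\iota_2,\iota_1)\}$, $$z_{T_p}(m;\xi,I,\tau_1,\tau_2)=\Delta^{-m}\big|_{\underline{X}=0}\,F_{T_p,\underline{\iota}}(\underline{X};\xi,I,\tau_1,\tau_2);$$ (3) $z_{T_p}(m;\xi,I,\tau_1,\tau_2)\in\mathbb{Q}(\mu_f)$ for all $m\in\mathbb{Z}_{\le0}$.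
   Context: $k$ is a real quadratic field with ring of integers $\mathcal{O}$, real embeddings $\iota_1$ (inclusion) and $\iota_2$. $I$ is a fractional ideal, $\xi$ an additive character of $I$ with values in complex roots of unity, with annihilator $\mathfrak{f}=\{a\in\mathcal{O}:\xi(ax)=1\ \forall x\in I\}\neq\mathcal{O}$; $\mathfrak f\cap\mathbb{Z}=f\mathbb{Z}$, $f>0$, $\mu_f$ the $f$-th roots of unity in $\mathbb{C}$. $\tau_1,\tau_2$ are $\mathbb{Q}$-linearly independent totally positive elements of $I$ with $\xi(\tau_1),\xi(\tau_2)\ne1$. Let $P(\tau_1,\tau_2)=\{\lambda\tau_1+\mu\tau_2:\lambda,\mu\in\mathbb{Q},0<\lambda\le1,0\le\mu<1\}$ and $C(\tau_1,\tau_2)=\{\lambda\tau_1+\mu\tau_2:\lambda,\mu\in\mathbb{Q},0<\lambda,0\le\mu\}$. For $a\in I\setminus\{0\}$, $|I:(a)|$ denotes the index of the principal ideal $(a)$ in $I$ (a positive integer). Define $$z_{T_p}(s;\xi,I,\tau_1,\tau_2)=\sum_{a\in I\cap C(\tau_1,\tau_2),\ p\nmid|I:(a)|}\frac{\xi(a)}{(\iota_1(a)\iota_2(a))^s}.$$ With formal variables $\underline X=(X_1,X_2)$, $(1+\underline X)^{(u_1,u_2)}=(1+X_1)^{u_1}(1+X_2)^{u_2}$ (formal binomial series), $\underline\iota(a)=(\iota_{\pi(1)}(a),\iota_{\pi(2)}(a))$ for $\underline\iota=(\iota_{\pi(1)},\iota_{\pi(2)})$, define $$F_{T_p,\underline\iota}(\underline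 X;\xi,I,\tau_1,\tau_2)=\frac{\sum_{\tilde a\in I\cap P(p\tau_1,p\tau_2),\ p\nmid |I:(\tilde a)|}\xi(\tilde a)(1+\underline X)^{\underline\iota(\tilde a)}}{(1-\xi(p\tau_1)(1+\underline X)^{\underline\iota(p\tau_1)})(1-\xi(p\tau_2)(1+\underline X)^{\underline\iota(p\tau_2)})},$$ a formal power series. $\Delta=(1+X_1)(1+X_2)\frac{\partial^2}{\partial X_1\partial X_2}$ and $\Delta^{-m}|_{\underline X=0}$ means apply $\Delta$ $(-m)$ times and take the constant term. *)

(* Defs.v *)
From HB Require Import structures.
From mathcomp Require Import all_boot all_order all_algebra all_field complex.
From mathcomp Require Import finmap zify.
From mathcomp Require Import all_classical all_reals all_analysis.
From mathcomp Require summability.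

Set Implicit Arguments.
Unset Strict Implicit.
Unset Printing Implicit Defensive.

Import Order.TTheory GRing.Theory Num.Theory.
Import numFieldNormedType.Exports.

Local Open Scope classical_set_scope.
Local Open Scope ring_scope.
Local Open Scope complex_scope.

Section NumberField.
Variable k : fieldExtType rat.
Implicit Types (I J : set k) (a b c d x : k).

Definition integers : set k := [set x | integralOver (intr : int -> k) x].

Definition fractional_ideal I : Prop :=
  [/\ exists2 a, I a & a != 0,
      forall a b, I a -> I b -> I (a + b),
      forall c a, integers c -> I a -> I (c * a) &
      exists2 d, integers d /\ d != 0 & forall a, I a -> integers (d * a)].

Definition principal a : set k := [set a * c | c in integers].

(* The number of cosets x + J with x in I; fset_set sends an infinite set to
   the empty one, so an infinite index is recorded as 0. *)
Definition index_in I J : nat :=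
  #|` fset_set [set [set x + y | y in J] | x in I] |.

(* The ideal (p, I) generated by p and I is the unit ideal. *)
Definition coprime_ideal (p : nat) I : Prop :=
  [set p%:R * a + b | a in integers & b in I] = integers.

Definition parallelogram (t1 t2 : k) : set k :=
  [set x | exists l m : rat,
     [/\ 0 < l <= 1, 0 <= m < 1 & x = l *: t1 + m *: t2]].

Definition cone (t1 t2 : k) : set k :=
  [set x | exists l m : rat, [/\ 0 < l, 0 <= m & x = l *: t1 + m *: t2]].

(* The elements of I whose index |I : (a)| is prime to p. *)
Definition prime_to (p : nat) I : set k :=
  [set a | I a /\ ~~ (p %| index_in I (principal a))%N].

Section Character.
Variables (C : fieldType) (xi : k -> C).

(* Only the values of xi on I are meaningful. *)
Definition additive_character I : Prop :=
  (forall a b, I a -> I b -> xi (a + b) = xi a * xi b) /\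
  (forall a, I a -> exists2 n : nat, (0 < n)%N & n.-unity_root (xi a)).

Definition annihilator I : set k :=
  [set a | integers a /\ forall x, I x -> xi (a * x) = 1].

End Character.
End NumberField.

Section CyclotomicField.
Variable C : fieldType.

(* Q(mu_f): the smallest subfield of C containing the f-th roots of unity. *)
Definition cyclotomic_field (f : nat) : set C :=
  [set z | forall S : {pred C}, GRing.divring_closed S ->
     (forall w, f.-unity_root w -> w \in S) -> z \in S].

End CyclotomicField.

(* G i j is the coefficient of X_1^i X_2^j in G. *)
Definition pseries2 (C : Type) := nat -> nat -> C.

Section PowerSeries.
Variable C : fieldType.
Implicit Types (G H : pseries2 C).

Definition ps_one : pseries2 C := fun i j => ((i == 0%N) && (j == 0%N))%:R.

Definition ps_sub G H : pseries2 C := fun i j => G i j - H i j.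

Definition ps_scale (c : C) G : pseries2 C := fun i j => c * G i j.

Definition ps_mul G H : pseries2 C :=
  fun i j => \sum_(a < i.+1) \sum_(b < j.+1) G a b * H (i - a)%N (j - b)%N.

(* For H with nonzero constant term h, H = h (1 - E) with E(0) = 0, and the
   inverse is h^-1 (1 + E + E^2 + ...); E^n has no term of total degree < n, so
   the coefficient at (i, j) only involves n <= i + j.  See ps_mulV. *)
Definition ps_inv H : pseries2 C :=
  let E := ps_sub ps_one (ps_scale (H 0%N 0%N)^-1 H) in
  fun i j =>
    (H 0%N 0%N)^-1 * \sum_(n < (i + j).+1) iter n (ps_mul E) ps_one i j.

Definition ps_div G H : pseries2 C := ps_mul G (ps_inv H).

Definition ps_d12 G : pseries2 C :=
  fun i j => G i.+1 j.+1 *+ (i.+1 * j.+1).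

(* Delta = (1 + X_1)(1 + X_2) d^2/dX_1 dX_2 *)
Definition ps_Delta G : pseries2 C :=
  ps_mul (fun i j => ((i <= 1)%N && (j <= 1)%N)%:R) (ps_d12 G).

Definition gbinom (u : C) (n : nat) : C :=
  (\prod_(i < n) (u - i%:R)) / n`!%:R.

(* (1 + X_1)^u1 (1 + X_2)^u2 *)
Definition ps_binomial (u1 u2 : C) : pseries2 C :=
  fun i j => gbinom u1 i * gbinom u2 j.

Lemma ps_mulBl G1 G2 H i j :
  ps_mul (ps_sub G1 G2) H i j = ps_mul G1 H i j - ps_mul G2 H i j.
Proof.
rewrite /ps_mul -sumrB; apply: eq_bigr => a _; rewrite -sumrB.
by apply: eq_bigr => b _; rewrite mulrBl.
Qed.

Lemma ps_mul1l H i j : ps_mul ps_one H i j = H i j.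
Proof.
rewrite /ps_mul /ps_one big_ord_recl big_ord_recl /= mul1r !subn0.
rewrite big1 ?addr0 => [|b _]; last by rewrite mul0r.
by rewrite big1 ?addr0 // => a _; rewrite big1 // => b _; rewrite mul0r.
Qed.

Lemma ps_iter_order E n i j : E 0%N 0%N = 0 -> (i + j < n)%N ->
  iter n (ps_mul E) ps_one i j = 0.
Proof.
move=> E0; elim: n i j => [//|n IHn] i j ijn /=.
rewrite /ps_mul big1 // => a _; rewrite big1 // => b _.
have [ab0|ab0] := eqVneq (a + b)%N 0%N.
  have /eqP := ab0; rewrite addn_eq0 => /andP[/eqP -> /eqP ->].
  by rewrite E0 mul0r.
rewrite IHn ?mulr0 //; have := ltn_ord a; have := ltn_ord b; lia.
Qed.

Lemma ps_mulV H i j : H 0%N 0%N != 0 -> ps_mul H (ps_inv H) i j = ps_one i j.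
Proof.
move=> H0; set h := H 0%N 0%N in H0 *.
pose E := ps_sub ps_one (ps_scale h^-1 H).
have E0 : E 0%N 0%N = 0 by rewrite /E /ps_sub /ps_scale /ps_one mulVf ?subrr.
pose P n := iter n (ps_mul E) ps_one.
have HE a b : h^-1 * H a b = ps_sub ps_one E a b.
  by rewrite /E /ps_sub opprB addrC subrK.
have -> : ps_mul H (ps_inv H) i j =
    \sum_(n < (i + j).+1) ps_mul (ps_sub ps_one E) (P n) i j.
  rewrite /ps_mul [RHS]exchange_big /=; apply: eq_bigr => a _.
  rewrite [RHS]exchange_big /=; apply: eq_bigr => b _.
  rewrite -mulr_sumr -HE /ps_inv -/h -/E [h^-1 * H a b]mulrC -mulrA.
  congr (_ * (_ * _)).
  rewrite -!(big_mkord xpredT (fun n => P n (i - a)%N (j - b)%N)).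
  rewrite [RHS](@big_cat_nat _ _ _ ((i - a) + (j - b)).+1) //=; last by lia.
  rewrite [X in _ = _ + X]big_nat_cond [X in _ = _ + X]big1 ?addr0 //.
  by move=> n /andP[/andP[ltn _] _]; exact: ps_iter_order.
under eq_bigr => n _ do rewrite ps_mulBl ps_mul1l.
rewrite -(big_mkord xpredT (fun n => P n i j - P n.+1 i j)).
rewrite (telescope_sumr_eq (fun n => - P n i j)) //=; last first.
  by move=> n _; rewrite opprK addrC.
have PN : P (i + j).+1 i j = 0 by apply: ps_iter_order.
by rewrite opprK [X in - X]PN oppr0 add0r.
Qed.

End PowerSeries.

Section ComplexAnalysis.
Variable R : realType.
Implicit Types (f g : R[i] -> R[i]) (w s : R[i]).

Definition analytic_at f w : Prop :=
  \forall z \near (w : R[i]^o), derivable (f : R[i]^o -> R[i]^o) z 1.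

Definition pole_at f w : Prop :=
  exists (n : nat) g, [/\ (0 < n)%N, analytic_at g w, g w != 0 &
    \forall z \near (w : R[i]^o)^', f z = g z / (z - w) ^+ n].

(* At a pole the value of f is irrelevant. *)
Definition meromorphic f : Prop :=
  forall w, analytic_at f w \/ pole_at f w.

Definition meromorphic_continuation (z Z : R[i] -> R[i]) : Prop :=
  meromorphic Z /\ forall s, 1 < complex.Re s -> Z s = z s.

Definition cexp s : R[i] :=
  (expR (complex.Re s))%:C * (cos (complex.Im s) +i* sin (complex.Im s)).

(* x ^ s for a positive real number x *)
Definition cpow (x : R) s : R[i] := cexp (s * (ln x)%:C).

Definition abs_summable (T : choiceType) (D : set T) (u : T -> R[i]) : Prop :=
  summable D (fun a => (complex.Re `|u a|)%:E).

(* The limit of the sums over finite sets. *)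
Definition csum (T : choiceType) (D : set T) (u : T -> R[i]) : R[i] :=
  summability.sum (fun a => (if a \in D then u a else 0) : R[i]^o).

End ComplexAnalysis.

Section Shintani.
Variables (R : realType) (k : fieldExtType rat).
Variables (iota1 iota2 : {rmorphism k -> R}) (p : nat) (xi : k -> R[i]).
Variables (I : set k) (tau1 tau2 : k).

Definition zTp_domain : set k :=
  prime_to p I `&` cone tau1 tau2.

Definition zTp_term (s : R[i]) (a : k) : R[i] :=
  xi a / cpow (iota1 a * iota2 a) s.

Definition zTp (s : R[i]) : R[i] :=
  csum zTp_domain (zTp_term s).

(* (1 + X)^(iota1 a, iota2 a) *)
Definition ps_pow (a : k) : pseries2 R[i] :=
  ps_binomial (iota1 a)%:C (iota2 a)%:C.

(* The order of iota1 and iota2 matters here: X_1 goes with iota1. *)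
Definition FTp : pseries2 R[i] :=
  let num : pseries2 R[i] := fun i j =>
    \sum_(a \in prime_to p I `&` parallelogram (p%:R * tau1) (p%:R * tau2))
       xi a * ps_pow a i j in
  let den t := ps_sub (ps_one R[i])
    (ps_scale (xi (p%:R * t)) (ps_pow (p%:R * t))) in
  ps_div num (ps_mul (den tau1) (den tau2)).

End Shintani.

(* Main.v *)
(* Write z1, z2 for the values of xi at p tau1, p tau2.  As p is prime to f they are
   still different from 1.  The condition on |I : (a)| only depends on a modulo pI, so
   the cone decomposes into finitely many translates x + N p tau1 + N p tau2, with x in
   the parallelogram, and the zeta function is a finite combination of the sums
     sum_{i, j >= 0} z1^i z2^j N(x + i p tau1 + j p tau2)^(-s).
   With E1, E2 the shifts in i and j, such a sum is the value at (0, 0) of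
   (1 - z1 E1)^-1 (1 - z2 E2)^-1 applied to the norm power.  Summing by parts K times,
     1/(1 - zE) = sum_{l < K} z^l/(1 - z)^(l+1) (E - 1)^l
                  + (z/(1 - z))^K (E - 1)^K/(1 - zE),
   and a K-th difference of N^(-s) decays like the power -2 Re s - K of the distance to
   the origin, so that the right-hand side converges for Re s > 1 - K/2 and gives the
   continuation, which is entire.  At s = -m the norm power is a polynomial of degree
   2m, hence the terms with K-th differences vanish for K > 2m, and what is left is the
   same expansion of F: there (1 + X)^u plays the role of evaluation at u, because
   Delta multiplies (1 + X)^u by u1 u2, and (1 + X)^u - 1 is nilpotent modulo high
   powers of X_1 and X_2. *)

Require Import Defs.
From HB Require Import structures.
From mathcomp Require Import fingroup cyclic pgroup.
From mathcomp Require Import all_boot all_order all_algebra all_field complex.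
From mathcomp Require Import finmap zify ring lra.
From mathcomp Require Import all_classical all_reals all_analysis.
From mathcomp Require summability.

Set Implicit Arguments.
Unset Strict Implicit.
Unset Printing Implicit Defensive.

Import Order.TTheory GRing.Theory Num.Theory.
Import numFieldNormedType.Exports.

Local Open Scope classical_set_scope.
Local Open Scope ring_scope.
Local Open Scope complex_scope.

(** * Unordered sums of complex numbers *)

(** The order K has to grow as Re s decreases, so the continuation chooses an order for each s. It
    is a single function only because the regularized value does not depend on K: raising K by one
    is a summation by parts in each index, valid once the K-th differences are summable.
    Differentiation in s multiplies a norm power by its logarithm, and differentiation along the
    cone lowers an exponent or the power of the logarithm. The estimates are therefore made for two
    real powers times a power of the logarithm, a family stable under both. Total positivity allows
    each embedding to be compared separately with i + j + 1. Analyticity rests on an explicit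
    second-order Taylor bound in s, summed over the lattice points. The values lie in Q(mu_f)
    because norms are rational and the coefficients z^l/(1 - z)^(l+1) only involve values of the
    character. *)

Section ComplexModulus.
Variable R : realType.
Implicit Types (z w : R[i]) (x : R).

Definition modulus z : R := complex.Re `|z|.

Lemma modulusE z : `|z| = (modulus z)%:C.
Proof. by rewrite /modulus normc_def. Qed.

Lemma modulus_ge0 z : 0 <= modulus z.
Proof. by rewrite -lecR -modulusE normr_ge0. Qed.

Lemma modulus0 : modulus 0 = 0.
Proof. by rewrite /modulus normr0. Qed.

Lemma modulus1 : modulus 1 = 1.
Proof. by rewrite /modulus normr1. Qed.

Lemma modulusN z : modulus (- z) = modulus z.
Proof. by rewrite /modulus normrN. Qed.

Lemma modulusB z w : modulus (z - w) = modulus (w - z).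
Proof. by rewrite -modulusN opprB. Qed.

Lemma modulusM z w : modulus (z * w) = modulus z * modulus w.
Proof. by apply: complexI; rewrite rmorphM /= -!modulusE normrM. Qed.

Lemma modulusX z n : modulus (z ^+ n) = modulus z ^+ n.
Proof. by apply: complexI; rewrite rmorphXn /= -!modulusE normrX. Qed.

Lemma modulus_real x : modulus x%:C = `|x|.
Proof. by rewrite /modulus normc_def /= expr0n addr0 sqrtr_sqr. Qed.

Lemma modulus_nat n : modulus n%:R = n%:R.
Proof.
have -> : n%:R = (n%:R : R)%:C :> R[i] by rewrite rmorph_nat.
by rewrite modulus_real ger0_norm.
Qed.

Lemma modulusD z w : modulus (z + w) <= modulus z + modulus w.
Proof. by rewrite -lecR rmorphD /= -!modulusE ler_normD. Qed.

Lemma modulus_eq0 z : (modulus z == 0) = (z == 0).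
Proof. by rewrite -(inj_eq (@complexI R)) -modulusE normr_eq0. Qed.

Lemma Re_le_modulus z : `|complex.Re z| <= modulus z.
Proof. by rewrite -lecR -modulusE normc_ge_Re. Qed.

Lemma Im_le_modulus z : `|complex.Im z| <= modulus z.
Proof.
rewrite /modulus normc_def /= -sqrtr_sqr ler_wsqrtr //.
by rewrite lerDr sqr_ge0.
Qed.

Lemma modulus_i : modulus 'i%C = 1.
Proof. by rewrite /modulus normc_def /= expr0n expr1n add0r sqrtr1. Qed.

Lemma modulus_le_ReIm z : modulus z <= `|complex.Re z| + `|complex.Im z|.
Proof.
rewrite {1}[z]complexE (le_trans (modulusD _ _)) //.
by rewrite modulusM modulus_i mul1r !modulus_real.
Qed.

Lemma modulus_sum (T : Type) (s : seq T) (u : T -> R[i]) :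
  modulus (\sum_(t <- s) u t) <= \sum_(t <- s) modulus (u t).
Proof.
elim: s => [|t s IHs]; first by rewrite !big_nil modulus0.
by rewrite !big_cons (le_trans (modulusD _ _)) // lerD2l.
Qed.

End ComplexModulus.

Lemma sum_subset_le (R : numDomainType) (T : eqType) (f : T -> R) (s s' : seq T) :
  (forall t, 0 <= f t) -> uniq s -> uniq s' -> {subset s <= s'} ->
  \sum_(t <- s) f t <= \sum_(t <- s') f t.
Proof.
move=> f0 us us' ss'; rewrite [leRHS](bigID (mem s)) /= -[leLHS]addr0.
apply: lerD; last by apply: sumr_ge0.
rewrite -[leRHS]big_filter le_eqVlt; apply/orP; left; apply/eqP/perm_big.
apply: uniq_perm; rewrite ?filter_uniq // => t; rewrite mem_filter.
by case: (boolP (t \in s)) => // /ss' ->.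
Qed.

Section UnorderedSums.
Variables (R : realType).

Definition abs_summ (T : eqType) (u : T -> R[i]) : Prop :=
  exists B : R, forall s, uniq s -> \sum_(t <- s) modulus (u t) <= B.

Definition has_sum (T : eqType) (u : T -> R[i]) (l : R[i]) : Prop :=
  forall e : R, 0 < e -> exists s0 : seq T, forall s, uniq s ->
    {subset s0 <= s} -> modulus (\sum_(t <- s) u t - l) < e.

Definition tsum (T : eqType) (u : T -> R[i]) : R[i] := xget 0 (has_sum u).

Section Basics.
Variable T : eqType.
Implicit Types (u v : T -> R[i]).

Lemma has_sum_bound u l B :
  (forall s, uniq s -> modulus (\sum_(t <- s) u t) <= B) ->
  has_sum u l -> modulus l <= B.
Proof.
move=> uB ul; apply/ler_addgt0Pr => e e0; have [s0 hs] := ul e e0.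
have := hs (undup s0) (undup_uniq _).
have sub : {subset s0 <= undup s0} by move=> t; rewrite mem_undup.
move=> /(_ sub) h.
have -> : l = \sum_(t <- undup s0) u t - (\sum_(t <- undup s0) u t - l).
  by rewrite opprB addrCA subrr addr0.
rewrite (le_trans (modulusD _ _)) // lerD ?uB ?undup_uniq // modulusN.
exact: ltW.
Qed.

Lemma has_sumD u v l m :
  has_sum u l -> has_sum v m -> has_sum (fun t => u t + v t) (l + m).
Proof.
move=> ul vm e e0; have e2 : 0 < e / 2 by rewrite divr_gt0.
have [s hs] := ul _ e2; have [s' hs'] := vm _ e2.
exists (s ++ s') => r ur sr; rewrite big_split /= opprD addrACA.
rewrite (le_lt_trans (modulusD _ _)) // [e]splitr ltrD //.
- by apply: hs => // t ts; apply: sr; rewrite mem_cat ts.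
- by apply: hs' => // t ts; apply: sr; rewrite mem_cat ts orbT.
Qed.

Lemma has_sumZ c u l : has_sum u l -> has_sum (fun t => c * u t) (c * l).
Proof.
move=> ul e e0.
have c1 : 0 < modulus c + 1 by rewrite ltr_wpDl ?modulus_ge0.
have [s0 hs] := ul (e / (modulus c + 1)) (divr_gt0 e0 c1).
exists s0 => s us ss; rewrite -mulr_sumr -mulrBr modulusM.
have [->|l0] := eqVneq (modulus (\sum_(t <- s) u t - l)) 0.
  by rewrite mulr0.
have {}h := hs s us ss; rewrite ltr_pdivlMr // mulrC in h.
rewrite (le_lt_trans _ h) // ler_wpM2r ?modulus_ge0 //.
by rewrite lerDl.
Qed.

Lemma has_sum_ext u v l : u =1 v -> has_sum u l -> has_sum v l.
Proof. by move=> uv ul; rewrite -(funext uv). Qed.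

Lemma has_sumB u v l m :
  has_sum u l -> has_sum v m -> has_sum (fun t => u t - v t) (l - m).
Proof.
move=> ul /(has_sumZ (-1)) vm; rewrite mulN1r in vm.
by apply: has_sum_ext (has_sumD ul vm) => t; rewrite mulN1r.
Qed.

Lemma has_sum0 : has_sum (fun _ : T => 0) 0.
Proof. by move=> e e0; exists [::] => s _ _; rewrite big1 // subrr modulus0. Qed.

Lemma has_sum_uniq u l m : has_sum u l -> has_sum u m -> l = m.
Proof.
move=> ul um; apply/eqP; rewrite -subr_eq0 -modulus_eq0 eq_le modulus_ge0 andbT.
apply: has_sum_bound (has_sumB ul um) => s _.
by rewrite big1 ?modulus0 // => t _; rewrite subrr.
Qed.

Lemma tsumE u l : has_sum u l -> tsum u = l.
Proof.
by move=> ul; apply: xget_unique => // m um; apply: has_sum_uniq um ul.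
Qed.

Lemma abs_summ_le (c : R) u v : (forall t, modulus (v t) <= c * modulus (u t)) ->
  abs_summ u -> abs_summ v.
Proof.
move=> vu [B hB]; exists (`|c| * B) => s us.
apply: (le_trans (y := \sum_(t <- s) `|c| * modulus (u t))).
  apply: ler_sum => t _; apply: le_trans (vu t) _.
  by rewrite ler_wpM2r ?modulus_ge0 // ler_norm.
by rewrite -mulr_sumr ler_wpM2l // hB.
Qed.

Lemma abs_summD u v : abs_summ u -> abs_summ v -> abs_summ (fun t => u t + v t).
Proof.
move=> [B hB] [B' hB']; exists (B + B') => s us.
apply: (le_trans (y := \sum_(t <- s) (modulus (u t) + modulus (v t)))).
  by apply: ler_sum => t _; exact: modulusD.
rewrite big_split /=; apply: lerD; [exact: hB | exact: hB'].
Qed.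

Lemma abs_summZ c u : abs_summ u -> abs_summ (fun t => c * u t).
Proof. by apply: (abs_summ_le (c := modulus c)) => t; rewrite modulusM. Qed.

Lemma abs_summN u : abs_summ u -> abs_summ (fun t => - u t).
Proof. by apply: (abs_summ_le (c := 1)) => t; rewrite modulusN mul1r. Qed.

Lemma abs_summB u v : abs_summ u -> abs_summ v -> abs_summ (fun t => u t - v t).
Proof. by move=> su sv; apply: abs_summD => //; exact: abs_summN. Qed.

Lemma abs_summ0 : abs_summ (fun _ : T => 0).
Proof. by exists 0 => s _; rewrite big1 // => t _; rewrite modulus0. Qed.

Lemma has_sum_nonneg (v : T -> R) (B : R) : (forall t, 0 <= v t) ->
  (forall s, uniq s -> \sum_(t <- s) v t <= B) ->
  exists l : R[i], has_sum (fun t => (v t)%:C) l.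
Proof.
move=> v0 vB; pose E := [set \sum_(t <- s) v t | s in [set s | uniq s]].
have supE : has_sup E.
  split; first by exists 0, [::] => //; rewrite big_nil.
  by exists B => _ [s us <-]; exact: vB.
exists (sup E)%:C => e e0; have [_ [s0 us0 <-] hs] := sup_adherent e0 supE.
exists s0 => s us ss; rewrite -rmorph_sum /= -rmorphB modulus_real.
have sE : \sum_(t <- s) v t <= sup E.
  by apply: sup_upper_bound => //; exists s.
rewrite distrC ger0_norm ?subr_ge0 // ltrBlDr -ltrBlDl.
by apply: lt_le_trans hs _; exact: sum_subset_le.
Qed.

(** Real and imaginary parts are summed separately. A real family r bounded by the modulus n is (r +
    n) - n, a difference of nonnegative families, whose sums are suprema. *)
Lemma abs_summ_has_sum u : abs_summ u -> exists l, has_sum u l.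
Proof.
move=> [B hB]; pose n t := modulus (u t).
have n0 t : 0 <= n t by exact: modulus_ge0.
have part (r : T -> R) : (forall t, `|r t| <= n t) ->
    exists l, has_sum (fun t => (r t)%:C) l.
  move=> rn.
  have [||l hl] := @has_sum_nonneg (fun t => r t + n t) (B + B).
  - by move=> t; have := rn t; rewrite ler_norml => /andP[]; lra.
  - move=> s us; rewrite big_split /= lerD ?hB //.
    apply: le_trans (hB s us); apply: ler_sum => t _.
    by apply: le_trans (rn t); exact: ler_norm.
  have [m hm] := has_sum_nonneg n0 hB.
  exists (l - m); apply: has_sum_ext (has_sumB hl hm) => t.
  by rewrite -rmorphB /= addrK.
have [a ha] := part _ (fun t => Re_le_modulus (u t)).
have [b hb] := part _ (fun t => Im_le_modulus (u t)).
exists (a + 'i%C * b); apply: has_sum_ext (has_sumD ha (has_sumZ 'i%C hb)) => t.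
by rewrite -complexE.
Qed.

Lemma tsumP u : abs_summ u -> has_sum u (tsum u).
Proof. by move=> /abs_summ_has_sum[l ul]; rewrite (tsumE ul). Qed.

Lemma tsumB u v : abs_summ u -> abs_summ v ->
  tsum (fun t => u t - v t) = tsum u - tsum v.
Proof. by move=> /tsumP su /tsumP sv; apply: tsumE; apply: has_sumB. Qed.

Lemma tsum_bound u B :
  (forall s, uniq s -> \sum_(t <- s) modulus (u t) <= B) -> modulus (tsum u) <= B.
Proof.
move=> uB; apply: (@has_sum_bound u); last by apply: tsumP; exists B.
by move=> s us; apply: le_trans (modulus_sum _ _) (uB s us).
Qed.

Lemma has_sum_bigfam (J : eqType) (r : seq J) (u : J -> T -> R[i]) (l : J -> R[i]) :
  {in r, forall j, has_sum (u j) (l j)} ->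
  has_sum (fun t => \sum_(j <- r) u j t) (\sum_(j <- r) l j).
Proof.
elim: r => [_|j r IHr ul].
  by rewrite big_nil; apply: has_sum_ext has_sum0 => t; rewrite big_nil.
rewrite big_cons; have uj := ul j (mem_head _ _).
have {}IHr := IHr (fun i ir => ul i (@mem_behead _ (j :: r) i ir)).
by apply: has_sum_ext (has_sumD uj IHr) => t; rewrite big_cons.
Qed.

Lemma abs_summ_bigfam (J : eqType) (r : seq J) (u : J -> T -> R[i]) :
  {in r, forall j, abs_summ (u j)} -> abs_summ (fun t => \sum_(j <- r) u j t).
Proof.
elim: r => [_|j r IHr us].
  by under eq_fun do rewrite big_nil; exact: abs_summ0.
have {}IHr := IHr (fun i ir => us i (@mem_behead _ (j :: r) i ir)).
by under eq_fun do rewrite big_cons; apply: abs_summD => //; apply: us; exact: mem_head.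
Qed.

End Basics.

Section Reindexing.
Variables (S T : eqType) (g : S -> T) (g_inj : injective g).

Lemma abs_summ_comp (u : T -> R[i]) : abs_summ u -> abs_summ (u \o g).
Proof.
move=> [B hB]; exists B => s us.
by have := hB (map g s); rewrite big_map map_inj_uniq //; apply.
Qed.

Let ginv (t : T) : option S :=
  match pselect (exists s, g s = t) with
  | left h => Some (projT1 (cid h))
  | right _ => None
  end.

Let ginvK : ocancel ginv g.
Proof. by move=> t; rewrite /ginv; case: pselect => //= h; case: cid. Qed.

Let gK : pcancel g ginv.
Proof.
move=> s; rewrite /ginv; case: pselect => [h|[]]; last by exists s.
by case: cid => s' /= /g_inj ->.
Qed.

Let sum_pmap (V : nmodType) (u : T -> V) (s : seq T) :
  (forall t, (forall x, g x <> t) -> u t = 0) ->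
  \sum_(t <- s) u t = \sum_(x <- pmap ginv s) u (g x).
Proof.
move=> u0; elim: s => [|t s IHs] /=; first by rewrite !big_nil.
rewrite big_cons IHs /=; have := ginvK t; case E: (ginv t) => [x|] /=.
  by move=> <-; rewrite big_cons.
move=> _; rewrite u0 ?add0r // => x xt.
by move: E; rewrite -xt gK.
Qed.

Lemma has_sum_image (u : T -> R[i]) l : (forall t, (forall x, g x <> t) -> u t = 0) ->
  has_sum (u \o g) l -> has_sum u l.
Proof.
move=> u0 ul e e0; have [s0 hs] := ul e e0.
exists (map g s0) => s us ss; rewrite (sum_pmap _ u0); apply: hs.
  exact: (pmap_uniq ginvK).
move=> x xs; rewrite mem_pmap; apply/mapP; exists (g x); last by rewrite gK.
by apply: ss; rewrite map_f.
Qed.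

Lemma abs_summ_image (u : T -> R[i]) : (forall t, (forall x, g x <> t) -> u t = 0) ->
  abs_summ (u \o g) -> abs_summ u.
Proof.
move=> u0 [B hB]; exists B => s us; rewrite (@sum_pmap _ (fun t => modulus (u t))).
  by apply: hB; exact: (pmap_uniq ginvK).
by move=> t /u0 ->; rewrite modulus0.
Qed.

End Reindexing.

Section LibrarySums.
Variable T : choiceType.

Lemma csum_has_sum (D : set T) (u : T -> R[i]) l :
  has_sum (fun t => if t \in D then u t else 0) l -> csum D u = l.
Proof.
move=> ul; rewrite /csum /summability.sum; apply: (@cvg_lim R[i]^o).
- exact: norm_hausdorff.
- exact: summability.totally_filter.
have FF := @filter_filter _ _ (@summability.totally_filter T).
apply/(@cvgrPdist_lt _ R[i]^o _ _ FF) => e e0.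
(* A positive element of [R[i]] is real, so the complex tolerance of the filter limit is a real
   one. *)
have er : e = (complex.Re e)%:C.
  by rewrite RRe_real // gtr0_real.
have [|s0 hs] := ul (complex.Re e); first by rewrite -ltcR -er.
exists [fset x in s0]%fset => // A /= s0A; rewrite /summability.partial_sum.
rewrite -(big_seq_fsetE _ A predT (fun t => if t \in D then u t else 0)) /=.
rewrite er modulusE ltcR modulusB; apply: hs; first exact: fset_uniq.
by move=> t ts; apply: (fsubsetP s0A); rewrite in_fset.
Qed.

Lemma abs_summ_summable (D : set T) (u : T -> R[i]) :
  abs_summ (fun t => if t \in D then u t else 0) -> abs_summable D u.
Proof.
move=> [B hB]; rewrite /abs_summable /summable; apply: (@le_lt_trans _ _ B%:E); last exact: ltry.
apply: ge_ereal_sup => _ [A [finA AD] <-].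
rewrite fsbig_finite //= (eq_bigr (fun t => (modulus (u t))%:E)); last first.
  by move=> t _; rewrite ger0_norm // modulus_ge0.
rewrite sumEFin lee_fin; apply: le_trans (hB (fset_set A) (fset_uniq _)).
rewrite big_seq [leRHS]big_seq; apply: ler_sum => t; rewrite in_fset_set // inE => /AD tD.
by rewrite mem_set.
Qed.

End LibrarySums.
End UnorderedSums.
(** * Regularized geometric sums *)

Section FiniteDifferences.
Variable V : zmodType.
Implicit Types (v w : nat -> V).

Definition fdiff v : nat -> V := fun n => v n.+1 - v n.

Lemma iter_fdiffD K v w n :
  iter K fdiff (fun i => v i + w i) n = iter K fdiff v n + iter K fdiff w n.
Proof.
by elim: K n => //= K IHK n; rewrite /fdiff !IHK opprD addrACA.
Qed.

Lemma iter_fdiffB K v w n :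
  iter K fdiff (fun i => v i - w i) n = iter K fdiff v n - iter K fdiff w n.
Proof.
by elim: K n => //= K IHK n; rewrite /fdiff !IHK !opprD addrACA.
Qed.

Lemma iter_fdiff_shift K v n m :
  iter K fdiff (fun i => v (i + m)%N) n = iter K fdiff v (n + m)%N.
Proof. by elim: K n => //= K IHK n; rewrite /fdiff !IHK addSn. Qed.

Lemma iter_fdiff_ext K v w n : v =1 w -> iter K fdiff v n = iter K fdiff w n.
Proof. by move=> /funext ->. Qed.

Lemma iter_fdiffSr K v n : iter K.+1 fdiff v n =
  iter K fdiff (fun i => v i.+1) n - iter K fdiff v n.
Proof. by rewrite iterSr -iter_fdiffB. Qed.

Definition fdiff1 (v : nat -> nat -> V) : nat -> nat -> V :=
  fun i j => v i.+1 j - v i j.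

Lemma iter_fdiff1E K (v : nat -> nat -> V) i j :
  iter K fdiff1 v i j = iter K fdiff (v ^~ j) i.
Proof. by elim: K i => //= K IHK i; rewrite /fdiff1 /fdiff !IHK. Qed.

End FiniteDifferences.

Lemma iter_fdiffZ (A : pzRingType) (c : A) K (v : nat -> A) n :
  iter K (@fdiff A) (fun i => c * v i) n = c * iter K (@fdiff A) v n.
Proof. by elim: K n => //= K IHK n; rewrite /fdiff !IHK mulrBr. Qed.

Section Regularization.
Variable R : realType.
Implicit Types (z : R[i]) (v w : nat -> R[i]) (phi : nat -> nat -> R[i]).
Local Notation fdiff := (@fdiff R[i]).
Local Notation fdiff1 := (@fdiff1 R[i]).

Lemma abs_summ_fdiff v K : abs_summ v -> abs_summ (iter K fdiff v).
Proof.
move=> sv; elim: K => //= K sK; apply: abs_summB => //.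
by apply: (@abs_summ_comp _ _ _ S) sK; exact: succn_inj.
Qed.

Lemma abs_summ_twist z v : modulus z <= 1 -> abs_summ v ->
  abs_summ (fun n => z ^+ n * v n).
Proof.
move=> z1; apply: (abs_summ_le (c := 1)) => n.
rewrite modulusM modulusX ler_wpM2r ?modulus_ge0 //.
by rewrite exprn_ile1 ?modulus_ge0.
Qed.

Lemma has_sum_single (T : eqType) (t0 : T) (a : R[i]) :
  has_sum (fun t => if t == t0 then a else 0) a.
Proof.
move=> e e0; exists [:: t0] => s us ss.
rewrite (bigD1_seq t0) ?ss ?inE //= eqxx big1 ?addr0 ?subrr ?modulus0 //.
by move=> t /negPf ->.
Qed.

Lemma tsum_recl v : abs_summ v -> tsum v = v 0%N + tsum (fun n => v n.+1).
Proof.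
move=> sv; apply: tsumE.
have h : has_sum (fun n => if n is m.+1 then v m.+1 else 0) (tsum (fun n => v n.+1)).
  apply: (@has_sum_image _ _ _ S); first exact: succn_inj.
    by case=> // n /(_ n).
  by apply: tsumP; apply: (@abs_summ_comp _ _ _ S) sv; exact: succn_inj.
apply: has_sum_ext (has_sumD (has_sum_single 0%N (v 0%N)) h).
by case=> [|n] /=; rewrite ?addr0 ?add0r.
Qed.

Lemma tsum2_recl (u : nat * nat -> R[i]) : abs_summ u ->
  tsum u = tsum (fun j => u (0%N, j)) + tsum (fun ij => u (ij.1.+1, ij.2)).
Proof.
move=> su; apply: tsumE.
have h1 : has_sum (fun ij : nat * nat => if ij.1 == 0%N then u ij else 0)
    (tsum (fun j => u (0%N, j))).
  apply: (@has_sum_image _ _ _ (fun j => (0%N, j))); first by move=> j j' [].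
    by case=> [[|i] j] //= /(_ j).
  by apply: tsumP; apply: (abs_summ_comp (g := fun j => (0%N, j))) su => j j' [].
have h2 : has_sum (fun ij : nat * nat => if ij.1 == 0%N then 0 else u ij)
    (tsum (fun ij => u (ij.1.+1, ij.2))).
  have ginj : injective (fun ij : nat * nat => (ij.1.+1, ij.2)).
    by case=> a b [c d] /= [-> ->].
  apply: (has_sum_image ginj); first by case=> [[|i] j] //= /(_ (i, j)).
  by apply: tsumP; exact: (abs_summ_comp ginj) su.
apply: has_sum_ext (has_sumD h1 h2).
by case=> [[|i] j] /=; rewrite ?addr0 ?add0r.
Qed.

(* 1/(1 - zE), with E the shift, expanded to order K in powers of E - 1: the value
   is [\sum_n z ^+ n * v n] when this converges, but [reg] only needs the K-th
   difference of [v] to be summable. *)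
Definition reg z K v : R[i] :=
  \sum_(l < K) z ^+ l / (1 - z) ^+ l.+1 * iter l fdiff v 0%N +
  (z / (1 - z)) ^+ K * tsum (fun n => z ^+ n * iter K fdiff v n).

(** Let A and A' be the twisted sums of [v] and of its shift. Then A = v 0 + z A', and the sum of
    the differences is A' - A; eliminating A' divides by 1 - z. *)
Lemma abel_summation z v : modulus z <= 1 -> z != 1 -> abs_summ v ->
  tsum (fun n => z ^+ n * v n) =
  v 0%N / (1 - z) + z / (1 - z) * tsum (fun n => z ^+ n * fdiff v n).
Proof.
move=> z1 zN1 sv; have z0 : 1 - z != 0 by rewrite subr_eq0 eq_sym.
have sS : abs_summ (fun n => v n.+1).
  by apply: (@abs_summ_comp _ _ _ S) sv; exact: succn_inj.
have -> : tsum (fun n => z ^+ n * fdiff v n) =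
    tsum (fun n => z ^+ n * v n.+1) - tsum (fun n => z ^+ n * v n).
  rewrite -tsumB; try exact: abs_summ_twist.
  by congr tsum; apply/funext => n; rewrite mulrBr.
have := tsum_recl (abs_summ_twist z1 sv); rewrite expr0 mul1r.
have -> : tsum (fun n => z ^+ n.+1 * v n.+1) = z * tsum (fun n => z ^+ n * v n.+1).
  apply: tsumE; apply: has_sum_ext (has_sumZ z (tsumP (abs_summ_twist z1 sS))).
  by move=> n; rewrite exprS mulrA.
by move: (tsum _) (tsum _) => A B AE; rewrite AE; field.
Qed.

Lemma reg_step z K v : modulus z <= 1 -> z != 1 -> abs_summ (iter K fdiff v) ->
  reg z K.+1 v = reg z K v.
Proof.
move=> z1 zN1 sv; have z0 : 1 - z != 0 by rewrite subr_eq0 eq_sym.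
rewrite /reg big_ord_recr /= (abel_summation z1 zN1 sv) -addrA; congr (_ + _).
by move: (tsum _) => A; rewrite !expr_div_n !exprS; field; rewrite z0 expf_neq0.
Qed.

Lemma reg_tsum z K v : modulus z <= 1 -> z != 1 -> abs_summ v ->
  reg z K v = tsum (fun n => z ^+ n * v n).
Proof.
move=> z1 zN1 sv; elim: K => [|K IHK].
  by rewrite /reg big_ord0 add0r expr0 mul1r.
by rewrite reg_step //; exact: abs_summ_fdiff.
Qed.

(** The expansion is made in the first index only: each boundary row i = 0 is a one-variable
    sequence regularized by [reg], and the remainder stays an unexpanded double sum. *)
Definition reg2 z1 z2 K phi : R[i] :=
  \sum_(l < K) z1 ^+ l / (1 - z1) ^+ l.+1 * reg z2 K (iter l fdiff1 phi 0%N) +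
  (z1 / (1 - z1)) ^+ K *
    tsum (fun ij : nat * nat => z1 ^+ ij.1 * z2 ^+ ij.2 * iter K fdiff1 phi ij.1 ij.2).

Lemma abs_summ_twist2 z1 z2 phi : modulus z1 <= 1 -> modulus z2 <= 1 ->
  abs_summ (fun ij : nat * nat => phi ij.1 ij.2) ->
  abs_summ (fun ij : nat * nat => z1 ^+ ij.1 * z2 ^+ ij.2 * phi ij.1 ij.2).
Proof.
move=> h1 h2; apply: (abs_summ_le (c := 1)) => -[i j] /=.
rewrite modulusM ler_wpM2r ?modulus_ge0 // modulusM !modulusX.
by rewrite mulr_ile1 ?exprn_ge0 ?exprn_ile1 ?modulus_ge0.
Qed.

Lemma abel_summation2 z1 z2 phi : modulus z1 <= 1 -> modulus z2 <= 1 -> z1 != 1 ->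
  abs_summ (fun ij : nat * nat => phi ij.1 ij.2) ->
  tsum (fun ij : nat * nat => z1 ^+ ij.1 * z2 ^+ ij.2 * phi ij.1 ij.2) =
  tsum (fun j => z2 ^+ j * phi 0%N j) / (1 - z1) +
  z1 / (1 - z1) *
    tsum (fun ij : nat * nat => z1 ^+ ij.1 * z2 ^+ ij.2 * fdiff1 phi ij.1 ij.2).
Proof.
move=> h1 h2 zN1 sv; have z0 : 1 - z1 != 0 by rewrite subr_eq0 eq_sym.
have ginj : injective (fun ij : nat * nat => (ij.1.+1, ij.2)).
  by case=> a b [c d] /= [-> ->].
have sS : abs_summ (fun ij : nat * nat => phi ij.1.+1 ij.2).
  exact: (abs_summ_comp ginj sv).
have sS2 := @abs_summ_twist2 z1 z2 (fun i j => phi i.+1 j) h1 h2 sS.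
have sV2 := @abs_summ_twist2 z1 z2 phi h1 h2 sv.
have -> : tsum (fun ij : nat * nat => z1 ^+ ij.1 * z2 ^+ ij.2 * fdiff1 phi ij.1 ij.2) =
    tsum (fun ij : nat * nat => z1 ^+ ij.1 * z2 ^+ ij.2 * phi ij.1.+1 ij.2)
    - tsum (fun ij : nat * nat => z1 ^+ ij.1 * z2 ^+ ij.2 * phi ij.1 ij.2).
  rewrite -tsumB //.
  by congr tsum; apply/funext => n; rewrite mulrBr.
have := tsum2_recl sV2; rewrite /=.
have -> : tsum (fun ij : nat * nat => z1 ^+ ij.1.+1 * z2 ^+ ij.2 * phi ij.1.+1 ij.2) =
    z1 * tsum (fun ij : nat * nat => z1 ^+ ij.1 * z2 ^+ ij.2 * phi ij.1.+1 ij.2).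
  apply: tsumE; apply: has_sum_ext (has_sumZ z1 (tsumP sS2)).
  by move=> n; rewrite exprS !mulrA.
have -> : (fun j => z1 ^+ 0 * z2 ^+ j * phi 0%N j) = (fun j => z2 ^+ j * phi 0%N j).
  by apply/funext => j; rewrite expr0 mul1r.
move: (tsum _) (tsum _) (tsum _) => A B C CE.
by rewrite CE; field.
Qed.

Lemma reg2_step z1 z2 K phi :
  modulus z1 <= 1 -> modulus z2 <= 1 -> z1 != 1 -> z2 != 1 ->
  (forall l, abs_summ (iter K fdiff (iter l fdiff1 phi 0%N))) ->
  abs_summ (fun ij : nat * nat => iter K fdiff1 phi ij.1 ij.2) ->
  reg2 z1 z2 K.+1 phi = reg2 z1 z2 K phi.
Proof.
move=> h1 h2 N1 N2 s1 s2; have z0 : 1 - z1 != 0 by rewrite subr_eq0 eq_sym.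
rewrite /reg2 big_ord_recr /= (abel_summation2 h1 h2 N1 s2) -addrA.
have s0 : abs_summ (iter K fdiff1 phi 0%N).
  by apply: (abs_summ_comp (g := fun j => (0%N, j))) s2 => j j' [].
congr (_ + _).
  by apply: eq_bigr => l _; rewrite reg_step.
(* The boundary row split off from the double sum converges, hence equals its own regularization,
   which is the new term l = K. *)
rewrite (reg_tsum _ h2 N2 s0); move: (tsum _) (tsum _) => A B.
by rewrite !expr_div_n !exprS; field; rewrite z0 expf_neq0.
Qed.

End Regularization.
(** * Finite differences of complex powers *)

Section RealVariable.
Variable R : realType.
Implicit Types (g h : R -> R[i]) (t : R).

(** Only real parameters occur, and the derivative is taken by components because the mean value
    theorem holds for real-valued functions. *)
Definition is_cderive g t (d : R[i]) : Prop :=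
  is_derive t (1 : R) (fun x => complex.Re (g x)) (complex.Re d) /\
  is_derive t (1 : R) (fun x => complex.Im (g x)) (complex.Im d).

Lemma is_derive_ext (f h : R -> R) t d d' : f =1 h -> d = d' ->
  is_derive t (1 : R) f d -> is_derive t (1 : R) h d'.
Proof. by move=> /funext <- <-. Qed.

Lemma ReD (z w : R[i]) : complex.Re (z + w) = complex.Re z + complex.Re w.
Proof. by case: z w => ? ? []. Qed.
Lemma ImD (z w : R[i]) : complex.Im (z + w) = complex.Im z + complex.Im w.
Proof. by case: z w => ? ? []. Qed.
Lemma ReN (z : R[i]) : complex.Re (- z) = - complex.Re z.
Proof. by case: z. Qed.
Lemma ImN (z : R[i]) : complex.Im (- z) = - complex.Im z.
Proof. by case: z. Qed.
Lemma ReM (z w : R[i]) : complex.Re (z * w) =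
  complex.Re z * complex.Re w - complex.Im z * complex.Im w.
Proof. by case: z w => ? ? []. Qed.
Lemma ImM (z w : R[i]) : complex.Im (z * w) =
  complex.Re z * complex.Im w + complex.Im z * complex.Re w.
Proof. by case: z w => ? ? []. Qed.

Lemma complex_eq (z w : R[i]) :
  complex.Re z = complex.Re w -> complex.Im z = complex.Im w -> z = w.
Proof. by case: z w => ? ? [? ?] /= -> ->. Qed.

Lemma is_cderive_ext g h t d d' : g =1 h -> d = d' ->
  is_cderive g t d -> is_cderive h t d'.
Proof. by move=> /funext <- <-. Qed.

Lemma is_cderive_cst (c : R[i]) t : is_cderive (fun _ => c) t 0.
Proof. by split; exact: is_derive_cst. Qed.

Lemma is_cderiveD g h t d e : is_cderive g t d -> is_cderive h t e ->
  is_cderive (fun x => g x + h x) t (d + e).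
Proof.
move=> [g1 g2] [h1 h2]; split.
- apply: is_derive_ext (is_deriveD g1 h1); last by rewrite ReD.
  by move=> x; rewrite ReD.
- apply: is_derive_ext (is_deriveD g2 h2); last by rewrite ImD.
  by move=> x; rewrite ImD.
Qed.

Lemma is_cderiveM g h t d e : is_cderive g t d -> is_cderive h t e ->
  is_cderive (fun x => g x * h x) t (d * h t + g t * e).
Proof.
move=> [g1 g2] [h1 h2]; split.
- apply: is_derive_ext (is_deriveB (is_deriveM g1 h1) (is_deriveM g2 h2)).
    by move=> x; rewrite ReM.
  by rewrite ReD !ReM /GRing.scale /=; ring.
- apply: is_derive_ext (is_deriveD (is_deriveM g1 h2) (is_deriveM g2 h1)).
    by move=> x; rewrite ImM.
  by rewrite ImD !ImM /GRing.scale /=; ring.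
Qed.

Lemma is_cderiveZ (c : R[i]) g t d : is_cderive g t d ->
  is_cderive (fun x => c * g x) t (c * d).
Proof.
move=> gd; apply: is_cderive_ext (is_cderiveM (is_cderive_cst c t) gd) => //.
by rewrite mul0r add0r.
Qed.

Lemma is_cderiveB g h t d e : is_cderive g t d -> is_cderive h t e ->
  is_cderive (fun x => g x - h x) t (d - e).
Proof.
move=> gd /(is_cderiveZ (-1)) he.
apply: is_cderive_ext (is_cderiveD gd he); last by rewrite mulN1r.
by move=> x; rewrite mulN1r.
Qed.

Lemma is_cderive_real (f : R -> R) t d : is_derive t (1 : R) f d ->
  is_cderive (fun x => (f x)%:C) t d%:C.
Proof. by move=> fd; split=> //=; exact: is_derive_cst. Qed.

Lemma Re_cexp (z : R[i]) : complex.Re (cexp z) = expR (complex.Re z) * cos (complex.Im z).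
Proof. by rewrite /cexp ReM /= mul0r subr0. Qed.
Lemma Im_cexp (z : R[i]) : complex.Im (cexp z) = expR (complex.Re z) * sin (complex.Im z).
Proof. by rewrite /cexp ImM /= mul0r addr0. Qed.

Lemma is_cderive_cexp g t d : is_cderive g t d ->
  is_cderive (fun x => cexp (g x)) t (d * cexp (g t)).
Proof.
move=> [g1 g2].
have ex := is_derive1_comp (is_derive_expR (complex.Re (g t))) g1.
have co := is_derive1_comp (is_derive_cos (complex.Im (g t))) g2.
have si := is_derive1_comp (is_derive_sin (complex.Im (g t))) g2.
split.
- apply: is_derive_ext (is_deriveM ex co); first by move=> x; rewrite Re_cexp.
  by rewrite ReM Re_cexp Im_cexp /GRing.scale /=; ring.
- apply: is_derive_ext (is_deriveM ex si); first by move=> x; rewrite Im_cexp.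
  by rewrite ImM Re_cexp Im_cexp /GRing.scale /=; ring.
Qed.

Lemma derive_bound (f df : R -> R) M :
  (forall t, 0 <= t <= 1 -> is_derive t (1 : R) f (df t)) ->
  (forall t, 0 <= t <= 1 -> `|df t| <= M) -> `|f 1 - f 0| <= M.
Proof.
move=> fd fM.
have [||c c01 ->] := @MVT_segment R f df 0 1 ler01.
- move=> x; rewrite in_itv /= => /andP[x0 x1].
  by apply: fd; rewrite !ltW.
- apply: derivable_within_continuous => x; rewrite in_itv /= => x01.
  by have := fd x x01 => -[].
by rewrite subr0 mulr1 fM // -in_itv.
Qed.

(** The mean value theorem is applied to the real and the imaginary part, which costs the factor
    2. *)
Lemma cderive_bound g (dg : R -> R[i]) M :
  (forall t, 0 <= t <= 1 -> is_cderive g t (dg t)) ->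
  (forall t, 0 <= t <= 1 -> modulus (dg t) <= M) -> modulus (g 1 - g 0) <= M *+ 2.
Proof.
move=> gd gM; apply: le_trans (modulus_le_ReIm _) _.
rewrite ReD ReN ImD ImN mulr2n; apply: lerD.
- apply: (@derive_bound (fun x => complex.Re (g x)) (fun t => complex.Re (dg t))).
    by move=> t /gd[].
  by move=> t /gM; apply: le_trans; exact: Re_le_modulus.
- apply: (@derive_bound (fun x => complex.Im (g x)) (fun t => complex.Im (dg t))).
    by move=> t /gd[].
  by move=> t /gM; apply: le_trans; exact: Im_le_modulus.
Qed.

(** [cderive_bound] is used twice, on g(t) - t g'(0) and on g' over [0, t]; each use contributes a
    factor 2. *)
Lemma taylor2_bound g (g' g'' : R -> R[i]) M :
  (forall t, 0 <= t <= 1 -> is_cderive g t (g' t)) ->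
  (forall t, 0 <= t <= 1 -> is_cderive g' t (g'' t)) ->
  (forall t, 0 <= t <= 1 -> modulus (g'' t) <= M) ->
  modulus (g 1 - g 0 - g' 0) <= M *+ 4.
Proof.
move=> gd gd' gM.
have M0 : 0 <= M by apply: le_trans (gM 0 _); rewrite ?modulus_ge0 ?lexx ?ler01.
pose h t := g t - t%:C * g' 0.
have -> : g 1 - g 0 - g' 0 = h 1 - h 0.
  by rewrite /h mul1r mul0r subr0 addrAC.
have -> : M *+ 4 = (M *+ 2) *+ 2 by rewrite -mulrnA.
apply: (@cderive_bound h (fun t => g' t - g' 0)).
  move=> t t01; apply: is_cderiveB; first exact: gd.
  apply: is_cderive_ext (is_cderiveM (is_cderive_real (is_derive_id t 1))
    (is_cderive_cst (g' 0) t)).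
    by [].
  by rewrite mulr0 addr0 mul1r.
move=> t /andP[t0 t1].
pose k s := g' (s * t).
have -> : g' t - g' 0 = k 1 - k 0 by rewrite /k mul1r mul0r.
apply: (@cderive_bound k (fun s => t%:C * g'' (s * t))); last first.
  move=> s /andP[s0 s1]; rewrite modulusM modulus_real ger0_norm //.
  rewrite (le_trans (y := 1 * modulus (g'' (s * t)))) //.
    by rewrite ler_wpM2r ?modulus_ge0.
  by rewrite mul1r gM // mulr_ge0 //= mulr_ile1.
move=> s /andP[s0 s1].
have st : 0 <= s * t <= 1 by rewrite mulr_ge0 //= mulr_ile1.
have [d1 d2] := gd' _ st.
have ds : is_derive s (1 : R) (fun x => x * t) t.
  apply: is_derive_ext (is_deriveM (is_derive_id s 1) (is_derive_cst t s 1)) => //.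
  by rewrite /GRing.scale /= mulr0 add0r mulr1.
split.
- apply: is_derive_ext (@is_derive1_comp R (fun x => complex.Re (g' x)) (fun x => x * t)
    s _ _ d1 ds) => //.
  by rewrite ReM /=; ring.
- apply: is_derive_ext (@is_derive1_comp R (fun x => complex.Im (g' x)) (fun x => x * t)
    s _ _ d2 ds) => //.
  by rewrite ImM /=; ring.
Qed.

Lemma is_cderive_fdiff K (g : R -> nat -> R[i]) (d : nat -> R[i]) t n :
  (forall m, is_cderive (fun x => g x m) t (d m)) ->
  is_cderive (fun x => iter K (@fdiff R[i]) (g x) n) t (iter K (@fdiff R[i]) d n).
Proof. by move=> gd; elim: K n => //= K IHK n; exact: is_cderiveB. Qed.

End RealVariable.

Lemma modulusD_le (R : realType) (z w : R[i]) (a b : R) :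
  modulus z <= a -> modulus w <= b -> modulus (z + w) <= a + b.
Proof. by move=> za wb; rewrite (le_trans (modulusD _ _)) // lerD. Qed.

(** * Products of two real powers and a power of the logarithm, and the decay of their
    differences *)

Section LogPowers.
Variable R : realType.
Implicit Types (al be z w : R[i]) (y : R).
Local Notation fdiff := (@fdiff R[i]).

Lemma cexpD z w : cexp (z + w) = cexp z * cexp w.
Proof.
apply: complex_eq.
  by rewrite [RHS]ReM !Re_cexp !Im_cexp ReD ImD expRD cosD; ring.
by rewrite [RHS]ImM !Re_cexp !Im_cexp ReD ImD expRD sinD; ring.
Qed.

Lemma cexp_real y : cexp y%:C = (expR y)%:C.
Proof. by rewrite /cexp /= cos0 sin0 mulr1. Qed.

Lemma cexp0 : cexp (0 : R[i]) = 1.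
Proof. by rewrite (_ : 0 = (0 : R)%:C) // cexp_real expR0. Qed.

Lemma modulus_cexp z : modulus (cexp z) = expR (complex.Re z).
Proof.
rewrite /cexp modulusM modulus_real ger0_norm ?expR_ge0 //.
by rewrite /modulus normc_def /= cos2Dsin2 sqrtr1 mulr1.
Qed.

Lemma cexp_neq0 z : cexp z != 0.
Proof. by rewrite -modulus_eq0 modulus_cexp gt_eqF // expR_gt0. Qed.

Lemma cexpN z : cexp (- z) = (cexp z)^-1.
Proof.
by apply: (mulfI (cexp_neq0 z)); rewrite -cexpD subrr cexp0 divff ?cexp_neq0.
Qed.

(* [y1 ^ al * y2 ^ be * ln (y1 * y2) ^+ j] *)
Definition logpow al be (j : nat) y1 y2 : R[i] :=
  cexp (al * (ln y1)%:C + be * (ln y2)%:C) * ((ln y1 + ln y2) ^+ j)%:C.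

Lemma cexp_lnN y : 0 < y -> cexp (- (ln y)%:C) = (y^-1)%:C.
Proof. by move=> y0; rewrite -rmorphN cexp_real expRN lnK. Qed.

Lemma logpow_decl al be j y1 y2 : 0 < y1 ->
  logpow (al - 1) be j y1 y2 = (y1^-1)%:C * logpow al be j y1 y2.
Proof.
move=> y0; rewrite /logpow mulrA -cexp_lnN // -cexpD; congr (cexp _ * _).
by ring.
Qed.

Lemma logpow_decr al be j y1 y2 : 0 < y2 ->
  logpow al (be - 1) j y1 y2 = (y2^-1)%:C * logpow al be j y1 y2.
Proof.
move=> y0; rewrite /logpow mulrA -cexp_lnN // -cexpD; congr (cexp _ * _).
by ring.
Qed.

(** The chain rule in the direction (a1, a2). For j = 0 the truncated predecessor is harmless, being
    multiplied by [j%:R]. *)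
Definition logpow_grad al be j (a1 a2 : R) y1 y2 : R[i] :=
  a1%:C * al * logpow (al - 1) be j y1 y2 + a2%:C * be * logpow al (be - 1) j y1 y2 +
  j%:R * (a1%:C * logpow (al - 1) be j.-1 y1 y2 + a2%:C * logpow al (be - 1) j.-1 y1 y2).

Lemma is_cderive_logpow al be j (Y1 Y2 : R -> R) (a1 a2 t : R) :
  0 < Y1 t -> 0 < Y2 t -> is_derive t (1 : R) Y1 a1 -> is_derive t (1 : R) Y2 a2 ->
  is_cderive (fun x => logpow al be j (Y1 x) (Y2 x)) t
    (logpow_grad al be j a1 a2 (Y1 t) (Y2 t)).
Proof.
move=> y1 y2 d1 d2.
have l1 := is_derive1_comp (is_derive1_ln y1) d1.
have l2 := is_derive1_comp (is_derive1_ln y2) d2.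
have ce := is_cderive_cexp (is_cderiveD (is_cderiveZ al (is_cderive_real l1))
  (is_cderiveZ be (is_cderive_real l2))).
have lj : is_cderive (fun x => ((ln (Y1 x) + ln (Y2 x)) ^+ j)%:C) t
    (j%:R * (ln (Y1 t) + ln (Y2 t)) ^+ j.-1 * ((Y1 t)^-1 * a1 + (Y2 t)^-1 * a2))%:C.
  apply: is_cderive_ext (is_cderive_real (is_deriveX j (is_deriveD l1 l2))) => //.
  by move=> x; rewrite /= fctE.
apply: is_cderive_ext (is_cderiveM ce lj); first by move=> x.
rewrite /logpow_grad !logpow_decl // !logpow_decr // /logpow /=.
set E := cexp _; set L := (_ + _ : R).
by rewrite !rmorphM rmorphD !rmorphM rmorph_nat /=; ring.
Qed.

(** Each derivative in the exponents brings down h times ln (y1 * y2); this is why the family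
    carries a power of the logarithm. *)
Lemma is_cderive_logpow_exponent al be h j y1 y2 t :
  is_cderive (fun x => logpow (al + x%:C * h) (be + x%:C * h) j y1 y2) t
    (h * logpow (al + t%:C * h) (be + t%:C * h) j.+1 y1 y2).
Proof.
have lin (c d : R[i]) : is_cderive (fun x => (c + x%:C * h) * d) t (h * d).
  apply: is_cderive_ext (is_cderiveM (is_cderiveD (is_cderive_cst c t)
    (is_cderiveM (is_cderive_real (is_derive_id t 1)) (is_cderive_cst h t)))
    (is_cderive_cst d t)) => //.
  by rewrite /=; ring.
have ce := is_cderive_cexp (is_cderiveD (lin al (ln y1)%:C) (lin be (ln y2)%:C)).
apply: is_cderive_ext (is_cderiveM ce (is_cderive_cst ((ln y1 + ln y2) ^+ j)%:C t)) => //.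
by rewrite /logpow /= mulr0 addr0 exprS rmorphM rmorphD /=; ring.
Qed.

Definition comparable_to (w M y : R) : Prop := w <= M * y /\ y <= M * w.

Lemma ln_comparable (w M y : R) : 1 <= w -> 1 <= M -> comparable_to w M y ->
  0 < y /\ `|ln y - ln w| <= ln M.
Proof.
move=> w1 M1 [wy yw].
have w0 : 0 < w by exact: lt_le_trans w1.
have M0 : 0 < M by exact: lt_le_trans M1.
have y0 : 0 < y by rewrite -(pmulr_rgt0 _ M0); exact: lt_le_trans wy.
split=> //; rewrite ler_norml; apply/andP; split.
- rewrite lerBrDr addrC lerBlDr addrC -lnM // ler_ln ?posrE //; exact: mulr_gt0.
- rewrite lerBlDr -lnM // ler_ln ?posrE //; exact: mulr_gt0.
Qed.

(** Replacing each y by w costs a factor M^N, and |ln y1 + ln y2| <= 2 ln M + 2 ln w <= (2 + 2 ln M)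
    w because w >= 1. *)
Lemma modulus_logpow_le (N M : R) j al be (w : R) y1 y2 : 1 <= M ->
  modulus al <= N -> modulus be <= N -> 1 <= w ->
  comparable_to w M y1 -> comparable_to w M y2 ->
  modulus (logpow al be j y1 y2) <=
    expR (N * ln M *+ 2) * (2 + ln M *+ 2) ^+ j *
    expR ((complex.Re al + complex.Re be + j%:R) * ln w).
Proof.
move=> M1 aN bN w1 c1 c2.
have [y10 l1] := ln_comparable w1 M1 c1; have [y20 l2] := ln_comparable w1 M1 c2.
have w0 : 0 < w by exact: lt_le_trans w1.
have lM0 : 0 <= ln M by exact: ln_ge0.
have lw0 : 0 <= ln w by exact: ln_ge0.
have part al' y : modulus al' <= N -> `|ln y - ln w| <= ln M ->
    complex.Re al' * ln y <= N * ln M + complex.Re al' * ln w.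
  move=> aN' ly; rewrite -lerBlDr -mulrBr.
  apply: le_trans (ler_norm _) _; rewrite normrM ler_pM //.
  by apply: le_trans aN'; exact: Re_le_modulus.
rewrite /logpow modulusM modulus_cexp modulus_real normrX.
rewrite [_ * ln w]mulrDl [expR (_ * ln w + _)]expRD mulrACA.
apply: ler_pM; rewrite ?expR_ge0 ?exprn_ge0 //.
  rewrite ReD !ReM /= !mulr0 !subr0 -expRD ler_expR mulr2n mulrDl addrACA.
  by apply: lerD; exact: part.
rewrite mulrC expRM_natl mulrC; rewrite -exprMn; apply: lerXn2r; rewrite ?nnegrE ?normr_ge0 //.
  by rewrite mulr_ge0 ?expR_ge0 // addr_ge0 // mulrn_wge0.
rewrite lnK ?posrE //.
have lw : ln w <= w by apply: le_trans (ltW (ln_sublinear w0)).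
have : `|ln y1 + ln y2| <= ln M *+ 2 + ln w *+ 2.
  have -> : ln y1 + ln y2 = (ln y1 - ln w) + (ln y2 - ln w) + ln w *+ 2 by ring.
  rewrite (le_trans (ler_normD _ _)) // lerD //; last first.
    by rewrite ger0_norm // mulrn_wge0.
  by rewrite (le_trans (ler_normD _ _)) // mulr2n lerD.
move/le_trans; apply; rewrite mulrDl addrC lerD //.
  by rewrite -[ln w *+ 2]mulr_natl ler_wpM2l.
by rewrite ler_peMr // mulrn_wge0.
Qed.

(* The derivative of [logpow] along (a1, a2) is a combination of functions [logpow]
   of total exponent one less, so by the mean value theorem each difference gains a
   factor 1/w; a power of the logarithm is crudely bounded by the same power of w. *)
Lemma fdiff_logpow_bound K j (N M a1 a2 : R) : 0 <= N -> 1 <= M -> 0 <= a1 -> 0 <= a2 ->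
  exists2 B, 0 <= B & forall al be (w : R) y1 y2,
    modulus al <= N -> modulus be <= N -> 1 <= w ->
    comparable_to w M y1 -> comparable_to w M y2 ->
    modulus (iter K fdiff (fun n => logpow al be j (y1 + n%:R * a1) (y2 + n%:R * a2)) 0%N)
    <= B * expR ((complex.Re al + complex.Re be + j%:R - K%:R) * ln w).
Proof.
move=> N0 M1 a10 a20; elim: K j N M N0 M1 => [|K IHK] j N M N0 M1.
  exists (expR (N * ln M *+ 2) * (2 + ln M *+ 2) ^+ j).
    by rewrite mulr_ge0 ?expR_ge0 // exprn_ge0 // addr_ge0 // mulrn_wge0 // ln_ge0.
  move=> al be w y1 y2 aN bN w1 c1 c2 /=; rewrite !mul0r !addr0 subr0.
  exact: modulus_logpow_le.
(* The induction hypothesis is needed with larger constants: a derivative shifts an exponent by one,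
   and the base points move by t * a with 0 <= t <= 1. *)
have N10 : 0 <= N + 1 by rewrite addr_ge0.
have M1' : 1 <= M + a1 + a2 by rewrite -addrA ler_wpDr // addr_ge0.
have [B1 B10 hB1] := IHK j _ _ N10 M1'.
have [B2 B20 hB2] := IHK j.-1 _ _ N10 M1'.
exists ((a1 * N * B1 + a2 * N * B1 + j%:R * (a1 * B2 + a2 * B2)) *+ 2).
  by rewrite mulrn_wge0 // !addr_ge0 ?mulr_ge0 ?addr_ge0 ?mulr_ge0.
move=> al be w y1 y2 aN bN w1 c1 c2.
have lw0 : 0 <= ln w by exact: ln_ge0.
have w0 : 0 <= w by exact: le_trans w1.
have [y10 _] := ln_comparable w1 M1 c1; have [y20 _] := ln_comparable w1 M1 c2.
(* The parameter t interpolates between the sequence at t = 0 and its shift at t = 1. *)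
pose g t n := logpow al be j (y1 + t * a1 + n%:R * a1) (y2 + t * a2 + n%:R * a2).
pose dg t n := logpow_grad al be j a1 a2 (y1 + t * a1 + n%:R * a1) (y2 + t * a2 + n%:R * a2).
have g1 : (fun n => logpow al be j (y1 + n.+1%:R * a1) (y2 + n.+1%:R * a2)) = g 1.
  apply/funext => n; rewrite /g -!natr1 !mul1r !mulrDl !mul1r.
  by rewrite [y1 + a1 + _]addrAC [y2 + a2 + _]addrAC !addrA.
have g0 : (fun n => logpow al be j (y1 + n%:R * a1) (y2 + n%:R * a2)) = g 0.
  by apply/funext => n; rewrite /g !mul0r !addr0.
rewrite iter_fdiffSr g1 g0 [leRHS]mulrnAl.
apply: (@cderive_bound _ (fun t => iter K fdiff (g t) 0%N) (fun t => iter K fdiff (dg t) 0%N)).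
  move=> t /andP[t0 t1]; apply: is_cderive_fdiff => m.
  have pos y a : 0 < y -> 0 <= a -> 0 < y + t * a + m%:R * a.
    by move=> y0 a0; rewrite -addrA ltr_wpDr // addr_ge0 // mulr_ge0.
  have lin y a : is_derive t (1 : R) (fun x => y + x * a + m%:R * a) a.
    apply: is_derive_ext (is_deriveD (is_deriveD (is_derive_cst y t 1)
      (is_deriveM (is_derive_id t 1) (is_derive_cst a t 1))) (is_derive_cst (m%:R * a) t 1)) => //.
    by rewrite /GRing.scale /=; ring.
  by apply: is_cderive_logpow; rewrite ?pos.
move=> t /andP[t0 t1].
have cmp y a : 0 < y -> 0 <= a -> a <= a1 + a2 -> comparable_to w M y ->
    comparable_to w (M + a1 + a2) (y + t * a).
  move=> y0 a0 aa [wy yw]; split.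
    have M0 : 0 <= M by exact: le_trans M1.
    apply: (le_trans wy); apply: ler_pM => //; first exact: ltW.
      by rewrite -addrA lerDl addr_ge0.
    by rewrite lerDl mulr_ge0.
  rewrite -addrA mulrDl lerD // (le_trans (y := 1 * (a1 + a2))) //.
    by apply: ler_pM.
  by rewrite mulrC ler_wpM2l ?addr_ge0.
have cy1 := cmp _ _ y10 a10 (ler_wpDr a20 (lexx a1)) c1.
have cy2 := cmp _ _ y20 a20 (ler_wpDl a10 (lexx a2)) c2.
pose D al be j := iter K fdiff
  (fun n => logpow al be j (y1 + t * a1 + n%:R * a1) (y2 + t * a2 + n%:R * a2)) 0%N.
have -> : iter K fdiff (dg t) 0%N =
    a1%:C * al * D (al - 1) be j + a2%:C * be * D al (be - 1) j +
    j%:R * (a1%:C * D (al - 1) be j.-1 + a2%:C * D al (be - 1) j.-1).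
  by rewrite /dg /logpow_grad /D !(iter_fdiffD, iter_fdiffZ).
have N1 z : modulus z <= N -> modulus (z - 1) <= N + 1.
  by move=> zN; rewrite (le_trans (modulusD _ _)) // modulusN modulus1 lerD2r.
have N1' z : modulus z <= N -> modulus z <= N + 1.
  by move=> zN; rewrite (le_trans zN) // lerDl.
set X := expR _.
have X0 : 0 <= X by exact: expR_ge0.
have e1 r : r <= complex.Re al + complex.Re be + j%:R - K.+1%:R -> expR (r * ln w) <= X.
  by move=> rX; rewrite ler_expR ler_wpM2r.
have jj : (j.-1%:R : R) <= j%:R by rewrite ler_nat leq_pred.
have R1 z : complex.Re (z - 1) = complex.Re z - 1 by rewrite ReD ReN.
have D1 : modulus (D (al - 1) be j) <= B1 * X.
  apply: le_trans (hB1 _ _ _ _ _ (N1 _ aN) (N1' _ bN) w1 cy1 cy2) _.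
  by rewrite ler_wpM2l // e1 // R1 -natr1; lra.
have D2 : modulus (D al (be - 1) j) <= B1 * X.
  apply: le_trans (hB1 _ _ _ _ _ (N1' _ aN) (N1 _ bN) w1 cy1 cy2) _.
  by rewrite ler_wpM2l // e1 // R1 -natr1; lra.
have D3 : modulus (D (al - 1) be j.-1) <= B2 * X.
  apply: le_trans (hB2 _ _ _ _ _ (N1 _ aN) (N1' _ bN) w1 cy1 cy2) _.
  by rewrite ler_wpM2l // e1 // R1 -natr1; lra.
have D4 : modulus (D al (be - 1) j.-1) <= B2 * X.
  apply: le_trans (hB2 _ _ _ _ _ (N1' _ aN) (N1 _ bN) w1 cy1 cy2) _.
  by rewrite ler_wpM2l // e1 // R1 -natr1; lra.
rewrite mulrDl mulrDl; apply: modulusD_le; first apply: modulusD_le.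
- rewrite !modulusM modulus_real ger0_norm // -!mulrA ler_wpM2l //.
  by apply: ler_pM; rewrite ?modulus_ge0.
- rewrite !modulusM modulus_real ger0_norm // -!mulrA ler_wpM2l //.
  by apply: ler_pM; rewrite ?modulus_ge0.
- rewrite modulusM modulus_nat -mulrA ler_wpM2l // mulrDl; apply: modulusD_le.
    by rewrite modulusM modulus_real ger0_norm // -mulrA ler_wpM2l.
  by rewrite modulusM modulus_real ger0_norm // -mulrA ler_wpM2l.
Qed.

End LogPowers.
(** * Fractional ideals of a real quadratic field *)

Section CosetCounting.
Variables (V : zmodType) (I J : set V).
Hypotheses (I0 : I 0) (IB : forall x y, I x -> I y -> I (x - y)).
Hypotheses (J0 : J 0) (JB : forall x y, J x -> J y -> J (x - y)).

Let JN x : J x -> J (- x). Proof. by rewrite -[- x]add0r; exact: JB. Qed.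
Let JD x y : J x -> J y -> J (x + y).
Proof. by move=> Jx /JN Jy; rewrite -[y]opprK; exact: JB. Qed.
Let IN x : I x -> I (- x). Proof. by rewrite -[- x]add0r; exact: IB. Qed.
Let ID x y : I x -> I y -> I (x + y).
Proof. by move=> Ix /IN Iy; rewrite -[y]opprK; exact: IB. Qed.

Definition coset_by x : set V := [set x + y | y in J].

Lemma coset_byP x y : coset_by x = coset_by y <-> J (x - y).
Proof.
split=> [xy|Jxy].
  have : coset_by x x by exists 0; rewrite ?addr0.
  by rewrite xy => -[z Jz <-]; rewrite addrAC subrr add0r.
apply/seteqP; split=> _ [z Jz <-].
  exists (x - y + z); first exact: JD.
  by rewrite addrA [y + (x - y)]addrC subrK.
exists (z - (x - y)); first exact: JB.
by rewrite opprB addrCA [x + _]addrC subrK addrC.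
Qed.

Let cosets : set (set V) := [set coset_by x | x in I].
Hypothesis fin : finite_set cosets.

(** The quotient I/J becomes a finite group carried by the very set that [index_in] counts, so that
    its order is the index. *)
Let G : finType := fset_set cosets.

Let addS (X Y : set V) : set V := [set u.1 + u.2 | u in X `*` Y].
Let oppS (X : set V) : set V := [set - u | u in X].

Let addSE x y : addS (coset_by x) (coset_by y) = coset_by (x + y).
Proof.
apply/seteqP; split=> [_ [[_ _] [[u Ju <-] [v Jv <-]] <-]|_ [z Jz <-]] /=.
  by exists (u + v); [exact: JD|rewrite addrACA].
by exists (x + z, y); [split; [exists z|exists 0]; rewrite ?addr0|rewrite /= addrAC].
Qed.

Let oppSE x : oppS (coset_by x) = coset_by (- x).
Proof.
apply/seteqP; split=> [_ [_ [u Ju <-] <-]|_ [z Jz <-]] /=.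
  by exists (- u); [exact: JN|rewrite opprD].
by exists (x - z); [exists (- z); [exact: JN|]|rewrite opprB addrC].
Qed.

Let memG x : I x -> coset_by x \in fset_set cosets.
Proof. by move=> Ix; rewrite in_fset_set // inE; exists x. Qed.

Let GP (X : G) : exists2 x, I x & coset_by x = val X.
Proof.
by have := valP X; rewrite in_fset_set // inE => -[x Ix <-]; exists x.
Qed.

Let mulG_in (X Y : G) : addS (val X) (val Y) \in fset_set cosets.
Proof.
by have [x Ix <-] := GP X; have [y Iy <-] := GP Y; rewrite addSE memG //; exact: ID.
Qed.
Let invG_in (X : G) : oppS (val X) \in fset_set cosets.
Proof. by have [x Ix <-] := GP X; rewrite oppSE memG //; exact: IN. Qed.

Let mk x (Ix : I x) : G := FSetSub (memG Ix).
Let oneG : G := mk I0.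
Let mulG (X Y : G) : G := FSetSub (mulG_in X Y).
Let invG (X : G) : G := FSetSub (invG_in X).

Let mulGA : associative mulG.
Proof.
move=> X Y Z; apply: val_inj => /=.
have [x _ <-] := GP X; have [y _ <-] := GP Y; have [z _ <-] := GP Z.
by rewrite !addSE addrA.
Qed.
Let mul1G : left_id oneG mulG.
Proof.
by move=> X; apply: val_inj => /=; have [x _ <-] := GP X; rewrite addSE add0r.
Qed.
Let mulVG : left_inverse oneG invG mulG.
Proof.
move=> X; apply: val_inj => /=; have [x _ <-] := GP X.
by rewrite oppSE addSE addNr.
Qed.

Let gT : finGroupType := HB.pack G (Finite_isGroup.Build G mulGA mul1G mulVG).

Let val_expg (X : gT) x n : val (X : G) = coset_by x ->
  val (expgn X n : G) = coset_by (x *+ n).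
Proof.
move=> Xx; elim: n => [|n IHn]; first by rewrite mulr0n.
rewrite expgS mulrS -addSE -Xx -IHn; reflexivity.
Qed.

(* For a finite abelian group, multiplication by p is onto iff p does not divide
   the order: Lagrange in one direction, Cauchy in the other. *)
Lemma coset_card_prime p : prime p ->
  ~~ (p %| #|` fset_set cosets|)%N <->
  (forall x, I x -> exists2 y, I y & J (x - y *+ p)).
Proof.
move=> p_pr; have cardG : #|` fset_set cosets| = #|[set: gT]%G|.
  by rewrite cardsT cardfE.
rewrite cardG; split=> [pG x Ix|psurj].
  have cop : coprime #|[set: gT]%G| p by rewrite coprime_sym prime_coprime.
  pose X : gT := mk Ix.
  have /esym XE := expgK cop (finset.in_setT X); rewrite -expgM in XE.
  (* The exponent m inverts p modulo the group order, so X is the p-th power of X^m. *)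
  set m := expg_invn _ _ in XE.
  exists (x *+ m).
    by elim: (m) => [|i IHi]; rewrite ?mulr0n // mulrS; exact: ID.
  apply/coset_byP; rewrite -mulrnA mulnC -(@val_expg X) //.
  by rewrite -XE.
apply/negP => pG; have [X _ oX] := Cauchy p_pr pG.
have psurjG (Y : gT) : {Z : gT | expgn Z p = Y}.
  apply: cid; have [y Iy yY] := GP Y; have [z Iz Jz] := psurj y Iy.
  exists (mk Iz : gT); apply: val_inj; rewrite (@val_expg _ z) // -yY.
  by apply/esym/coset_byP.
pose h Y := projT1 (psurjG Y).
have hK : cancel h (fun Z : gT => expgn Z p) by move=> Y; rewrite /h; case: (psurjG Y).
(* On a finite set a right inverse is also a left inverse, so the p-th power map is injective; it
   cannot kill an element of order p. *)
have /can_inj pinj := canF_sym hK.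
have X1 : X = 1%g by apply: pinj; rewrite /= -oX expg_order expg1n.
by move: oX p_pr; rewrite X1 order1 => <-.
Qed.

End CosetCounting.

(** * Traces and norms, the ideal as a lattice, and the index condition at p *)

Section QuadraticField.
Variables (R : realType) (k : fieldExtType rat).
Hypothesis k_quadratic : \dim {:k}%VS = 2%N.
Implicit Types (x y u v : k).

Lemma free2_decomp u v x : free [:: u; v] -> exists l m : rat, x = l *: u + m *: v.
Proof.
move=> fr; have full : <<[:: u; v]>>%VS = fullv.
  by apply/eqP; rewrite eqEdim subvf k_quadratic (eqP fr).
have : x \in <<[:: u; v]>>%VS by rewrite full memvf.
rewrite span_cons span_seq1 => /memv_addP[_ /vlineP[l ->] [_ /vlineP[m ->] ->]].
by exists l, m.
Qed.

Lemma free2_inj u v (l m l' m' : rat) : free [:: u; v] ->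
  l *: u + m *: v = l' *: u + m' *: v -> l = l' /\ m = m'.
Proof.
rewrite free_cons span_seq1 seq1_free => /andP[uv v0] /eqP.
rewrite -subr_eq0 opprD addrACA -!scalerBl.
have [->|ll'] := eqVneq l l'.
  by rewrite subrr scale0r add0r scaler_eq0 subr_eq0 (negPf v0) orbF => /eqP ->.
rewrite addr_eq0 => /eqP E; case/negP: uv; apply/vlineP.
exists ((l - l')^-1 * (m' - m)); rewrite -scalerA; apply/esym.
by rewrite -[m' - m]opprB scaleNr -E scalerA mulVf ?scale1r // subr_eq0.
Qed.

Lemma iota_scale (iota : {rmorphism k -> R}) (q : rat) x :
  iota (q *: x) = ratr q * iota x.
Proof. exact: rmorphZ_num. Qed.

Variables (iota1 iota2 : {rmorphism k -> R}).
Hypothesis iota_neq : exists x, iota1 x <> iota2 x.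

(** Otherwise x and 1 would span k, and the two embeddings would coincide. *)
Lemma eq_embeddings_rat x : iota1 x = iota2 x -> exists q : rat, x = q *: 1.
Proof.
move=> ixx; apply/vlineP; apply: contrapT => /negP xN.
have fr : free [:: x; 1] by rewrite free_cons span_seq1 seq1_free oner_eq0 xN.
have [y []] := iota_neq; have [l [m ->]] := free2_decomp y fr.
by rewrite !rmorphD !iota_scale ixx !rmorph1.
Qed.

(** If the embeddings agree at x, then x is rational. Otherwise x^2 = a x + b in the basis x, 1;
    subtracting the two images of this relation and dividing by iota1 x - iota2 x gives the trace a,
    and then the norm -b. *)
Lemma trace_norm_rat x : exists t n : rat,
  [/\ iota1 x + iota2 x = ratr t, iota1 x * iota2 x = ratr n &
      x * x = t *: x - n *: 1].
Proof.
have [ixx|nxx] := eqVneq (iota1 x) (iota2 x).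
  have [q ->] := eq_embeddings_rat ixx.
  exists (q + q), (q * q); rewrite !iota_scale !rmorph1 !mulr1 rmorphD rmorphM.
  split=> //; rewrite -scalerAl mul1r !scalerA -scalerBl; congr (_ *: _).
  by ring.
have xN : x \notin <[1]>%VS.
  by apply/negP => /vlineP[q xq]; move: nxx; rewrite xq !iota_scale !rmorph1 eqxx.
have fr : free [:: x; 1] by rewrite free_cons span_seq1 seq1_free oner_eq0 xN.
have [a [b E]] := free2_decomp (x * x) fr.
have E1 : iota1 x * iota1 x = ratr a * iota1 x + ratr b.
  by rewrite -rmorphM E rmorphD !iota_scale rmorph1 mulr1.
have E2 : iota2 x * iota2 x = ratr a * iota2 x + ratr b.
  by rewrite -rmorphM E rmorphD !iota_scale rmorph1 mulr1.
have nz : iota1 x - iota2 x != 0 by rewrite subr_eq0.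
have S : iota1 x + iota2 x = ratr a.
  apply: (mulfI nz); have -> : (iota1 x - iota2 x) * (iota1 x + iota2 x) =
    iota1 x * iota1 x - iota2 x * iota2 x by ring.
  by rewrite E1 E2; ring.
exists a, (- b); split=> //; last by rewrite scaleNr opprK.
have -> : iota1 x * iota2 x = iota1 x * (iota1 x + iota2 x) - iota1 x * iota1 x by ring.
by rewrite S E1 rmorphN /=; ring.
Qed.

Local Notation O := (@integers k).

Lemma integersD x y : O x -> O y -> O (x + y).
Proof. exact: integral_add. Qed.
Lemma integersB x y : O x -> O y -> O (x - y).
Proof. exact: integral_sub. Qed.
Lemma integersM x y : O x -> O y -> O (x * y).
Proof. exact: integral_mul. Qed.
Lemma integers_int (m : int) : O m%:~R.
Proof. exact: integral_id. Qed.
Lemma integers_nat (m : nat) : O m%:R.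
Proof. exact: integral_nat. Qed.
Lemma integers1 : O 1.
Proof. exact: integral1. Qed.

Lemma integral_embedding (iota : {rmorphism k -> R}) x :
  O x -> integralOver (intr : int -> R) (iota x).
Proof.
move=> /(integral_rmorph iota)[p pm pr]; exists p => //.
by rewrite (eq_map_poly (g := iota \o intr)) // => m; rewrite /= rmorph_int.
Qed.

(** The monic integer equation is carried over to [algC], where a rational algebraic integer is
    known to be an integer. *)
Lemma integral_rat_int (q : rat) : integralOver (intr : int -> R) (ratr q) ->
  exists m : int, q = m%:~R.
Proof.
move=> [p pm pr].
have pq : root (map_poly (intr : int -> rat) p) q.
  rewrite -(fmorph_root (@ratr R)) -map_poly_comp (eq_map_poly (g := intr)) //.
  by move=> m; rewrite /= ratr_int.
have pc : root (map_poly (intr : int -> algC) p) (ratr q).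
  rewrite -(fmorph_root (@ratr algC)) -map_poly_comp in pq.
  by rewrite (eq_map_poly (g := intr)) // in pq; move=> m; rewrite /= ratr_int.
have qA : (ratr q : algC) \in Aint.
  apply: root_monic_Aint pc _ _; first by rewrite monic_map.
  by apply/polyOverP => i; rewrite coef_map /= intr_int.
have /intrP[m qm] := Cint_rat_Aint (Crat_rat q) qA.
by exists m; apply: (fmorph_inj (@ratr algC)); rewrite /= qm ratr_int.
Qed.

Lemma trace_int x : O x -> exists m : int, iota1 x + iota2 x = m%:~R.
Proof.
move=> Ox; have [t [_ [tE _ _]]] := trace_norm_rat x.
have [|m mE] := @integral_rat_int t; last by exists m; rewrite tE mE ratr_int.
by rewrite -tE; apply: integral_add; exact: integral_embedding.
Qed.

Lemma intk_eq0 (m : int) : (m%:~R == 0 :> k) = (m == 0).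
Proof. by rewrite -(fmorph_eq0 iota1) rmorph_int intr_eq0. Qed.

Lemma integer_multiple x : exists2 m : int, m != 0 & O (m%:~R * x).
Proof.
have [t [n [_ _ xx]]] := trace_norm_rat x.
exists (denq t * denq n); first by rewrite mulf_neq0 ?denq_neq0.
(* Multiplying x^2 = t x - n by (denq t * denq n)^2 gives y^2 - a y + b = 0 for y = denq t * denq n
   * x. *)
pose a := numq t * denq n; pose b := numq n * denq n * denq t * denq t.
exists (('X - a%:P) * 'X + b%:P).
  rewrite monicE lead_coefDl ?(monicP (monicMr _ _)) ?monicX ?monicXsubC //.
    by rewrite -monicE rpredM ?monicX ?monicXsubC.
  by rewrite size_mulX ?polyXsubC_eq0 // size_XsubC; apply: leq_ltn_trans (size_polyC_leq1 _) _.
rewrite /root rmorphD rmorphM rmorphB /= !map_polyX !map_polyC /=.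
rewrite hornerD hornerM hornerD hornerN hornerX !hornerC.
have kq (q : rat) : q *: (1 : k) = (numq q)%:~R / (denq q)%:~R.
  by rewrite alg_num_field /ratr.
have dt : (denq t)%:~R != 0 :> k by rewrite intk_eq0 denq_neq0.
have dn : (denq n)%:~R != 0 :> k by rewrite intk_eq0 denq_neq0.
move: xx; rewrite -[t *: x]mulr_algl !kq => xx.
have -> : ((denq t * denq n)%:~R * x - a%:~R) * ((denq t * denq n)%:~R * x) + b%:~R =
   ((denq t)%:~R * (denq n)%:~R) ^+ 2 *
   (x * x - ((numq t)%:~R / (denq t)%:~R * x - (numq n)%:~R / (denq n)%:~R)).
  by rewrite /a /b !rmorphM /=; field; rewrite dt dn.
by rewrite xx subrr mulr0.
Qed.

Variables (I : set k) (tau1 tau2 : k).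
Hypotheses (I_frac : fractional_ideal I) (It1 : I tau1) (It2 : I tau2).
Hypothesis tau_free : free [:: tau1; tau2].

Lemma idealD x y : I x -> I y -> I (x + y).
Proof. by have [_ + _ _] := I_frac; apply. Qed.
Lemma idealM c x : O c -> I x -> I (c * x).
Proof. by have [_ _ + _] := I_frac; apply. Qed.
Lemma ideal_int (m : int) x : I x -> I (m%:~R * x).
Proof. by apply: idealM; exact: integers_int. Qed.
Lemma ideal_nat (m : nat) x : I x -> I (m%:R * x).
Proof. by apply: idealM; exact: integers_nat. Qed.
Lemma idealB x y : I x -> I y -> I (x - y).
Proof.
move=> Ix Iy; apply: idealD => //.
by have := ideal_int (-1) Iy; rewrite rmorphN1 mulN1r.
Qed.
Lemma ideal0 : I 0.
Proof. by rewrite -(subrr tau1); exact: idealB. Qed.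

(* D is the Gram determinant of d tau1, d tau2 for the trace form, where d is a
   denominator of I; it is nonzero because the determinant of the embeddings of
   tau1, tau2 is. *)
Lemma ideal_lattice : exists2 D : int, D != 0 &
  forall x, I x -> exists i j : int, D%:~R * x = i%:~R * tau1 + j%:~R * tau2.
Proof.
have [_ _ _ [d [Od d0] dI]] := I_frac.
pose T x := iota1 x + iota2 x.
have TI x y : I x -> I y -> exists m : int, T ((d * x) * (d * y)) = m%:~R.
  by move=> Ix Iy; apply: trace_int; apply: integersM; exact: dI.
have [e11 E11] := TI _ _ It1 It1; have [e12 E12] := TI _ _ It1 It2.
have [e22 E22] := TI _ _ It2 It2.
have TZ (q : rat) x : T (q *: x) = ratr q * T x.
  by rewrite /T !iota_scale mulrDr.
have TD x y : T (x + y) = T x + T y by rewrite /T !rmorphD addrACA.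
exists (e11 * e22 - e12 * e12).
  apply/eqP => D0.
  have {}D0 : (iota1 tau1 * iota2 tau2 - iota2 tau1 * iota1 tau2) ^+ 2 = 0.
    have := congr1 (fun z : int => z%:~R : R) D0; rewrite /= rmorphB !rmorphM /=.
    rewrite -E11 -E12 -E22 /T !rmorphM /= => E.
    have dd : (iota1 d * iota2 d) ^+ 2 != 0.
      by rewrite expf_neq0 // mulf_neq0 // fmorph_eq0.
    by apply: (mulfI dd); rewrite mulr0 -[RHS]E; ring.
  move/eqP: D0; rewrite expf_eq0 /= subr_eq0 => /eqP D0.
  move: (tau_free); rewrite free_cons span_seq1 seq1_free => /andP[/negP t12 t20].
  (* A vanishing determinant means that both embeddings agree on tau1 / tau2, which is then
     rational, against the independence of tau1 and tau2. *)
  have [|q qE] := @eq_embeddings_rat (tau1 / tau2).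
    rewrite !fmorph_div; apply/eqP; rewrite eqr_div ?fmorph_eq0 //.
    by rewrite D0.
  by apply: t12; apply/vlineP; exists q; rewrite -mulr_algl -qE divfK.
move=> x Ix; have [l [m xE]] := free2_decomp x tau_free.
have [i1 F1] := TI _ _ Ix It1; have [i2 F2] := TI _ _ Ix It2.
have ratT (a b c : int) : ratr l * a%:~R + ratr m * b%:~R = c%:~R :> R ->
    l * a%:~R + m * b%:~R = c%:~R.
  move=> E; apply: (fmorph_inj (@ratr R)).
  by rewrite rmorphD !rmorphM /= !ratr_int.
have G1 : l * e11%:~R + m * e12%:~R = i1%:~R.
  apply: ratT; rewrite -E11 -E12 -F1 -!TZ -TD; congr T.
  by rewrite xE mulrDr mulrDl -!scalerAr -!scalerAl [d * tau2 * (d * tau1)]mulrC.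
have G2 : l * e12%:~R + m * e22%:~R = i2%:~R.
  apply: ratT; rewrite -E22 -E12 -F2 -!TZ -TD; congr T.
  by rewrite xE mulrDr mulrDl -!scalerAr -!scalerAl.
(* Cramer's rule for the equations [G1] and [G2] in the coordinates l and m. *)
exists (i1 * e22 - i2 * e12), (e11 * i2 - e12 * i1).
have ints (z : int) : z%:~R = (z%:~R : rat)%:A :> k.
  by rewrite alg_num_field ratr_int.
have -> : (e11 * e22 - e12 * e12)%:~R * x =
    (l * (e11 * e22 - e12 * e12)%:~R) *: tau1 + (m * (e11 * e22 - e12 * e12)%:~R) *: tau2.
  by rewrite xE ints mulr_algl scalerDr !scalerA; congr (_ *: _ + _ *: _); rewrite mulrC.
rewrite !ints !mulr_algl; congr (_ *: _ + _ *: _).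
  by rewrite !rmorphB !rmorphM /= -G1 -G2; ring.
by rewrite !rmorphB !rmorphM /= -G1 -G2; ring.
Qed.

Variables (p : nat) (p_prime : prime p).

(** The right-hand side says pI + (a) = I, that is, multiplication by p is onto on I/(a), and
    [coset_card_prime] applies. Finiteness of I/(a) comes first, since an infinite index is recorded
    as 0. *)
Lemma prime_toP a : I a -> a != 0 ->
  prime_to p I a <-> forall x, I x -> exists2 y, I y & exists2 c, O c & x = p%:R * y + a * c.
Proof.
move=> Ia a0; pose J := principal a.
have J0 : J 0 by exists 0; [exact: (integers_nat 0)|rewrite mulr0].
have JB x y : J x -> J y -> J (x - y).
  by move=> [c Oc <-] [e Oe <-]; exists (c - e); [exact: integersB|rewrite mulrBr].
have [D D0 hD] := ideal_lattice.
have [m1 m10 Om1] := integer_multiple (tau1 / a).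
have [m2 m20 Om2] := integer_multiple (tau2 / a).
(* Integer multiples of tau1 / a and tau2 / a are integral, so a common multiple sends the Z-span of
   tau1 and tau2 into (a). *)
have [N N0 hN] : exists2 N : int, N != 0 &
    forall i j : int, J (N%:~R * (i%:~R * tau1 + j%:~R * tau2)).
  exists (m1 * m2); first by rewrite mulf_neq0.
  move=> i j.
  exists (i%:~R * m2%:~R * (m1%:~R * (tau1 / a)) + j%:~R * m1%:~R * (m2%:~R * (tau2 / a))).
    by apply: integersD; apply: integersM => //; apply: integersM; exact: integers_int.
  by rewrite rmorphM /=; field.
have Dk : D%:~R != 0 :> k by rewrite intk_eq0.
have fin : finite_set [set coset_by J x | x in I].
  (* As D x = i tau1 + j tau2, changing i or j by a multiple of D N changes x by an element of (a).
     Reducing both coordinates modulo D N therefore reaches every coset. *)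
  pose DN := D * N; pose b := `|DN|%N.
  pose h (rs : 'I_b * 'I_b) := coset_by J ((rs.1%:R * tau1 + rs.2%:R * tau2) / D%:~R).
  apply: (@sub_finite_set _ _ (h @` setT)); last exact/finite_image/finite_finset.
  move=> _ [x Ix <-]; have [i [j E]] := hD x Ix.
  have DNk : DN%:~R = D%:~R * N%:~R :> k by rewrite rmorphM.
  have DN0 : DN != 0 by rewrite mulf_neq0.
  have bnd (z : int) : (`|(z %% DN)%Z| < b)%N.
    by rewrite /b -ltz_nat abszE ger0_norm ?modz_ge0 // abszE ltz_mod.
  exists (Ordinal (bnd i), Ordinal (bnd j)) => //; apply/coset_byP => //=.
  have absE (z : int) : (`|(z %% DN)%Z|%:R : k) = z%:~R - (z %/ DN)%Z%:~R * (D%:~R * N%:~R).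
    have -> : (`|(z %% DN)%Z|%:R : k) = (z %% DN)%Z%:~R.
      by rewrite pmulrn abszE ger0_norm ?modz_ge0.
    have := congr1 (fun m : int => m%:~R : k) (divz_eq z DN).
    rewrite /= rmorphD rmorphM /= => ->; rewrite DNk; ring.
  have -> : (`|(i %% DN)%Z|%:R * tau1 + `|(j %% DN)%Z|%:R * tau2) / D%:~R - x =
     N%:~R * ((- (i %/ DN)%Z)%:~R * tau1 + (- (j %/ DN)%Z)%:~R * tau2).
    apply: (mulfI Dk); rewrite mulrBr E mulrC divfK // !absE !rmorphN /=; ring.
  exact: hN.
have := @coset_card_prime k I J ideal0 idealB J0 JB fin p p_prime.
have idxE : index_in I (principal a) = #|` fset_set [set coset_by J x | x in I]| by [].
rewrite /prime_to /= idxE.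
move=> [h1 h2]; split.
  move=> [_ /h1 h] x /h[y Iy [c Oc xE]]; exists y => //; exists c => //.
  by rewrite xE mulr_natl addrC subrK.
move=> h; split=> //; apply: h2 => x /h[y Iy [c Oc xE]]; exists y => //.
by exists c => //; rewrite xE mulr_natl addrAC subrr add0r.
Qed.

(* By [prime_toP], |I : (a)| is prime to p exactly when pI + (a) = I, which only
   depends on a modulo pI. *)
Lemma prime_to_shift a b : I b -> a != 0 -> a + p%:R * b != 0 ->
  prime_to p I a -> prime_to p I (a + p%:R * b).
Proof.
move=> Ib a0 ab0 pa; have Ia : I a by case: pa.
have Iab : I (a + p%:R * b) by apply: idealD => //; exact: ideal_nat.
apply/prime_toP => // x Ix; have /prime_toP := pa => /(_ Ia a0 x Ix)[y Iy [c Oc xE]].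
exists (y - c * b); first by apply: idealB => //; exact: idealM.
by exists c => //; rewrite xE; ring.
Qed.

End QuadraticField.
(** * Power series in two variables *)

Section BivariateSeries.
Variable C : numFieldType.
Implicit Types (G H : pseries2 C) (P Q : {poly {poly C}}) (u v : C) (N m : nat).
Local Notation fdiff := (@fdiff C).
Local Notation fdiff1 := (@fdiff1 C).

Lemma gbinom0 u : gbinom u 0 = 1.
Proof. by rewrite /gbinom big_ord0 fact0 divr1. Qed.

Lemma gbinomS u n : n.+1%:R * gbinom u n.+1 = (u - n%:R) * gbinom u n.
Proof.
rewrite /gbinom big_ord_recr /= factS natrM; field.
by rewrite nat1r !pnatr_eq0 -lt0n fact_gt0.
Qed.

(** In the inductive step the factor n+1 is split as i + (n+1-i), and [gbinomS] absorbs each part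
    into one of the two coefficients. *)
Lemma Vandermonde_gbinom u v n :
  gbinom (u + v) n = \sum_(i < n.+1) gbinom u i * gbinom v (n - i)%N.
Proof.
elim: n => [|n IHn]; first by rewrite big_ord1 !gbinom0 mulr1.
have n0 : n.+1%:R != 0 :> C by rewrite pnatr_eq0.
apply: (mulfI n0); rewrite gbinomS IHn mulr_sumr.
have -> : n.+1%:R * (\sum_(i < n.+2) gbinom u i * gbinom v (n.+1 - i)%N) =
    \sum_(i < n.+2) i%:R * gbinom u i * gbinom v (n.+1 - i)%N +
    \sum_(i < n.+2) gbinom u i * ((n.+1 - i)%N%:R * gbinom v (n.+1 - i)%N).
  rewrite mulr_sumr -big_split; apply: eq_bigr => i _ /=.
  by rewrite natrB ?leq_ord //; ring.
rewrite [in RHS]big_ord_recl /= !mul0r add0r.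
rewrite [X in _ = _ + X]big_ord_recr /= subnn mulr0n mul0r mulr0 addr0.
rewrite -big_split; apply: eq_bigr => i _ /=.
rewrite /bump /= add1n subSS gbinomS subSn ?leq_ord // gbinomS natrB ?leq_ord //.
by ring.
Qed.

(** Series are replaced by bivariate polynomials, the outer variable being X_1, so that ring
    identities and powers are at hand; only coefficients below X_1^N and X_2^N matter. *)
Definition represents N G P := forall i j, (i < N)%N -> (j < N)%N -> G i j = P`_i`_j.

Definition congr_trunc N P Q := forall i j, (i < N)%N -> (j < N)%N -> P`_i`_j = Q`_i`_j.

Definition trunc N G : {poly {poly C}} := \poly_(i < N) \poly_(j < N) G i j.

Lemma trunc_represents N G : represents N G (trunc N G).
Proof. by move=> i j iN jN; rewrite coef_poly iN coef_poly jN. Qed.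

Lemma represents_mul N G H P Q : represents N G P -> represents N H Q ->
  represents N (ps_mul G H) (P * Q).
Proof.
move=> GP HQ i j iN jN; rewrite /ps_mul coefM coef_sum; apply: eq_bigr => a _.
rewrite coefM; apply: eq_bigr => b _; rewrite GP ?HQ //.
- exact: leq_ltn_trans (leq_subr _ _) iN.
- exact: leq_ltn_trans (leq_subr _ _) jN.
- exact: leq_ltn_trans (leq_ord a) iN.
- exact: leq_ltn_trans (leq_ord b) jN.
Qed.

Lemma represents_congr N G P Q : represents N G P -> represents N G Q ->
  congr_trunc N P Q.
Proof. by move=> GP GQ i j iN jN; rewrite -GP // GQ. Qed.

Lemma congr_trunc_mul N P P' Q Q' : congr_trunc N P P' -> congr_trunc N Q Q' ->
  congr_trunc N (P * Q) (P' * Q').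
Proof.
move=> PP QQ; pose f P : pseries2 C := fun i j => P`_i`_j.
apply: (@represents_congr N (ps_mul (f P) (f Q))).
  by apply: represents_mul.
by apply: represents_mul => i j iN jN; rewrite /f ?PP ?QQ.
Qed.

Lemma congr_trunc_refl N P : congr_trunc N P P. Proof. by []. Qed.

Lemma congr_trunc_trans N P Q S :
  congr_trunc N P Q -> congr_trunc N Q S -> congr_trunc N P S.
Proof. by move=> PQ QS i j iN jN; rewrite PQ // QS. Qed.

Lemma congr_trunc_sym N P Q : congr_trunc N P Q -> congr_trunc N Q P.
Proof. by move=> PQ i j iN jN; rewrite PQ. Qed.

Lemma represents_one N : represents N (ps_one C) 1.
Proof.
move=> i j _ _; rewrite /ps_one coef1; case: i => [|i] /=; last by rewrite coef0.
by rewrite coef1.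
Qed.

Lemma coef_scalar (c : C) P i j : (c%:P%:P * P)`_i`_j = c * P`_i`_j.
Proof. by rewrite !coefCM. Qed.

Lemma coef_order P n i j : P`_0`_0 = 0 -> (i + j < n)%N -> (P ^+ n)`_i`_j = 0.
Proof.
move=> P0; elim: n i j => [//|n IHn] i j ijn.
rewrite exprS coefM coef_sum big1 // => a _; rewrite coefM big1 // => b _.
have [ab0|ab0] := eqVneq (a + b)%N 0%N.
  have /eqP := ab0; rewrite addn_eq0 => /andP[/eqP -> /eqP ->].
  by rewrite P0 mul0r.
rewrite IHn ?mulr0 //; have := ltn_ord a; have := ltn_ord b; lia.
Qed.

Definition Delta0 m G : C := iter m (@ps_Delta C) G 0%N 0%N.

Lemma ps_DeltaE G i j : ps_Delta G i j =
  \sum_(a < i.+1) \sum_(b < j.+1) ((a <= 1)%N && (b <= 1)%N)%:R *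
     (G (i - a).+1 (j - b).+1 *+ ((i - a).+1 * (j - b).+1)).
Proof. by []. Qed.

Lemma ps_Delta_local N G H :
  (forall i j, (i < N.+1)%N -> (j < N.+1)%N -> G i j = H i j) ->
  forall i j, (i < N)%N -> (j < N)%N -> ps_Delta G i j = ps_Delta H i j.
Proof.
move=> GH i j iN jN; rewrite !ps_DeltaE; apply: eq_bigr => a _.
apply: eq_bigr => b _; rewrite GH // ltnS.
  exact: leq_ltn_trans (leq_subr _ _) iN.
exact: leq_ltn_trans (leq_subr _ _) jN.
Qed.

(** One application of Delta at (i, j) looks at indices up to (i+1, j+1), so m applications at the
    origin see at most order m in each variable. *)
Lemma Delta0_local m G H :
  (forall i j, (i < m.+1)%N -> (j < m.+1)%N -> G i j = H i j) ->
  Delta0 m G = Delta0 m H.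
Proof.
move=> GH; suff h n k : (n + k = m)%N -> forall i j, (i < k.+1)%N -> (j < k.+1)%N ->
    iter n (@ps_Delta C) G i j = iter n (@ps_Delta C) H i j.
  by apply: (h m 0%N); rewrite ?addn0.
elim: n k => [|n IHn] k nk; first by have -> : k = m by rewrite -nk.
by apply: ps_Delta_local; apply: IHn; rewrite addnS -nk.
Qed.

Lemma Delta0_lin m (c : C) G H :
  Delta0 m (fun i j => c * G i j + H i j) = c * Delta0 m G + Delta0 m H.
Proof.
rewrite /Delta0.
suff -> : iter m (@ps_Delta C) (fun i j => c * G i j + H i j) =
  (fun i j => c * iter m (@ps_Delta C) G i j + iter m (@ps_Delta C) H i j) by [].
elim: m => //= m ->; apply/funext => i; apply/funext => j.
rewrite !ps_DeltaE mulr_sumr -big_split; apply: eq_bigr => a _ /=.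
rewrite mulr_sumr -big_split; apply: eq_bigr => b _ /=.
by rewrite mulrnDl -mulrnAr; ring.
Qed.

Definition Delta0p m P : C := Delta0 m (fun i j => P`_i`_j).

Lemma Delta0p_congr m P Q : congr_trunc m.+1 P Q -> Delta0p m P = Delta0p m Q.
Proof. by move=> PQ; apply: Delta0_local. Qed.

Lemma Delta0p_lin m c P Q :
  Delta0p m (c%:P%:P * P + Q) = c * Delta0p m P + Delta0p m Q.
Proof.
rewrite /Delta0p -Delta0_lin; apply: Delta0_local => i j _ _.
by rewrite !coefD coef_scalar.
Qed.

Lemma Delta0p0 m : Delta0p m 0 = 0.
Proof.
have := Delta0p_lin m 1 0 0; rewrite mulr0 addr0 mul1r => /eqP.
by rewrite addrC -subr_eq subrr eq_sym => /eqP.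
Qed.

Lemma Delta0p_scale m c P : Delta0p m (c%:P%:P * P) = c * Delta0p m P.
Proof. by rewrite -[_ * P]addr0 Delta0p_lin Delta0p0 addr0. Qed.

Lemma Delta0pB m P Q : Delta0p m (P - Q) = Delta0p m P - Delta0p m Q.
Proof.
have -> : P - Q = (-1)%:P%:P * Q + P by rewrite !rmorphN1 mulN1r addrC.
by rewrite Delta0p_lin mulN1r addrC.
Qed.

Lemma Delta0p_sum m (J : Type) (r : seq J) (F : J -> {poly {poly C}}) :
  Delta0p m (\sum_(x <- r) F x) = \sum_(x <- r) Delta0p m (F x).
Proof.
elim: r => [|x r IHr]; first by rewrite !big_nil Delta0p0.
rewrite !big_cons -IHr; have := Delta0p_lin m 1 (F x) (\sum_(x <- r) F x).
by rewrite !mul1r.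
Qed.

(** In one variable (1 + X) d/dX multiplies (1 + X)^w by w, which is [D1]; Delta is the product of
    these operators in X_1 and X_2. *)
Lemma ps_Delta_binomial u v i j :
  ps_Delta (ps_binomial u v) i j = u * v * ps_binomial u v i j.
Proof.
have D1 (w : C) n : \sum_(a < n.+1) (a <= 1)%N%:R * ((n - a).+1%:R * gbinom w (n - a).+1) =
    w * gbinom w n.
  under eq_bigr do rewrite gbinomS.
  case: n => [|n]; first by rewrite big_ord1 /= subr0 mul1r.
  rewrite !big_ord_recl /= big1 ?addr0 => [|a _]; last by rewrite mul0r.
  rewrite !mul1r subn0 /bump /= addn0 subn1 /= -[(w - n%:R) * _]gbinomS -natr1; ring.
rewrite ps_DeltaE /ps_binomial mulrACA -!D1 mulr_suml; apply: eq_bigr => a _.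
rewrite mulr_sumr; apply: eq_bigr => b _.
by rewrite -[(gbinom _ _ * _) *+ _]mulr_natr -mulnb !natrM; ring.
Qed.

Lemma Delta0_binomial m u v : Delta0 m (ps_binomial u v) = (u * v) ^+ m.
Proof.
suff h i j : iter m (@ps_Delta C) (ps_binomial u v) i j = (u * v) ^+ m * ps_binomial u v i j.
  by rewrite /Delta0 h /ps_binomial !gbinom0 !mulr1.
elim: m i j => [|m IHm] i j; first by rewrite mul1r.
rewrite iterS; have -> : iter m (@ps_Delta C) (ps_binomial u v) =
    (fun i j => (u * v) ^+ m * ps_binomial u v i j + 0).
  by apply/funext => a; apply/funext => b; rewrite IHm addr0.
rewrite ps_DeltaE exprSr -[RHS]mulrA -ps_Delta_binomial ps_DeltaE mulr_sumr.
apply: eq_bigr => a _; rewrite mulr_sumr; apply: eq_bigr => b _.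
by rewrite addr0 -mulrnAr; ring.
Qed.

(** * Binomial series as evaluation functionals, and inversion of the denominator *)

Section Evaluation.
Variable m : nat.
Let N := m.+1.
Definition binomp u v : {poly {poly C}} := trunc N (ps_binomial u v).

Lemma binompD u v u' v' :
  congr_trunc N (binomp u v * binomp u' v') (binomp (u + u') (v + v')).
Proof.
apply: (@represents_congr N (ps_mul (ps_binomial u v) (ps_binomial u' v'))).
  by apply: represents_mul; exact: trunc_represents.
move=> i j iN jN; rewrite -(@trunc_represents N) // /ps_binomial !Vandermonde_gbinom.
rewrite mulr_suml; apply: eq_bigr => a _; rewrite mulr_sumr; apply: eq_bigr => b _.
by rewrite mulrACA.
Qed.

Lemma binomp00 u v : (binomp u v)`_0`_0 = 1.
Proof. by rewrite -(@trunc_represents N) // /ps_binomial !gbinom0 mulr1. Qed.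

Variables (a1 a2 b1 b2 : C).

Definition norm_pow x1 x2 : nat -> nat -> C := fun n1 n2 =>
  ((x1 + n1%:R * a1 + n2%:R * b1) * (x2 + n1%:R * a2 + n2%:R * b2)) ^+ m.

(** Multiplying (1 + X)^x by (1 + X)^a - 1 takes a difference in the exponent, and Delta^m at 0
    turns (1 + X)^x into the m-th power of x1 x2. This is the dictionary between F and the zeta
    values. *)
Lemma Delta0p_fdiff x1 x2 j l n1 n2 :
  Delta0p m (binomp (x1 + n1%:R * a1 + n2%:R * b1) (x2 + n1%:R * a2 + n2%:R * b2) *
     (binomp a1 a2 - 1) ^+ j * (binomp b1 b2 - 1) ^+ l) =
  iter l fdiff (iter j fdiff1 (norm_pow x1 x2) n1) n2.
Proof.
elim: l n2 => [|l IHl] n2.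
  rewrite mulr1 /=; elim: j n1 => [|j IHj] n1.
    rewrite mulr1 /= -[RHS]Delta0_binomial; apply: Delta0_local => i j iN jN.
    by rewrite -(@trunc_represents N).
  rewrite /= /fdiff1 -!IHj -Delta0pB; apply: Delta0p_congr.
  rewrite exprS mulrA mulrBr mulr1 mulrBl => i k iN kN.
  rewrite !coefB; congr (_ - _).
  apply: congr_trunc_mul iN kN; last exact: congr_trunc_refl.
  have -> : x1 + n1.+1%:R * a1 + n2%:R * b1 = x1 + n1%:R * a1 + n2%:R * b1 + a1.
    by rewrite -natr1; ring.
  have -> : x2 + n1.+1%:R * a2 + n2%:R * b2 = x2 + n1%:R * a2 + n2%:R * b2 + a2.
    by rewrite -natr1; ring.
  exact: binompD.
rewrite /= /fdiff -!IHl -Delta0pB; apply: Delta0p_congr.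
rewrite exprS mulrA [_ * (binomp b1 b2 - 1)]mulrAC [_ * (binomp b1 b2 - 1)]mulrBr mulr1.
rewrite -!mulrA [(_ - _) * _]mulrBl => i k iN kN.
rewrite !coefB; congr (_ - _).
apply: congr_trunc_mul iN kN; last exact: congr_trunc_refl.
have -> : x1 + n1%:R * a1 + n2.+1%:R * b1 = x1 + n1%:R * a1 + n2%:R * b1 + b1.
  by rewrite -natr1; ring.
have -> : x2 + n1%:R * a2 + n2.+1%:R * b2 = x2 + n1%:R * a2 + n2%:R * b2 + b2.
  by rewrite -natr1; ring.
exact: binompD.
Qed.

(** Without constant term, the K-th power has only terms of total degree at least K > 2m, while the
    retained monomials have degree at most 2m. *)
Lemma binomp_sub1_nilp u v K : (m.*2.+1 <= K)%N ->
  congr_trunc N ((binomp u v - 1) ^+ K) 0.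
Proof.
move=> mK i j iN jN; rewrite coef_order ?coef0 //.
  by rewrite !coefB binomp00 !coef1 subrr.
by move: mK iN jN; rewrite /N; lia.
Qed.

(** High differences of a polynomial of degree 2m vanish; here this is read off from nilpotence on
    the side of power series. *)
Lemma fdiff_norm_pow0 x1 x2 K l n1 n2 : (m.*2.+1 <= K)%N ->
  iter K fdiff (iter l fdiff1 (norm_pow x1 x2) n1) n2 = 0.
Proof.
move=> mK; rewrite -Delta0p_fdiff -(Delta0p0 m); apply: Delta0p_congr.
rewrite -[0](mulr0 (binomp (x1 + n1%:R * a1 + n2%:R * b1) (x2 + n1%:R * a2 + n2%:R * b2) *
     (binomp a1 a2 - 1) ^+ l)).
by apply: congr_trunc_mul; [exact: congr_trunc_refl|exact: binomp_sub1_nilp].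
Qed.

Lemma fdiff1_norm_pow0 x1 x2 K n1 n2 : (m.*2.+1 <= K)%N ->
  iter K fdiff1 (norm_pow x1 x2) n1 n2 = 0.
Proof.
move=> mK; have := @Delta0p_fdiff x1 x2 K 0 n1 n2 => /= <-; rewrite -(Delta0p0 m).
apply: Delta0p_congr; rewrite mulr1.
rewrite -[0](mulr0 (binomp (x1 + n1%:R * a1 + n2%:R * b1) (x2 + n1%:R * a2 + n2%:R * b2))).
by apply: congr_trunc_mul; [exact: congr_trunc_refl|exact: binomp_sub1_nilp].
Qed.

(** The expansion of 1/(1 - z(1 + Y)) in powers of Y = (1 + X)^u - 1, cut at order K; the
    coefficients are those of [reg]. *)
Definition geomp z u v K : {poly {poly C}} :=
  \sum_(j < K) (z ^+ j / (1 - z) ^+ j.+1)%:P%:P * (binomp u v - 1) ^+ j.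

Lemma geomp_inv z u v K : z != 1 -> (m.*2.+1 <= K)%N ->
  congr_trunc N ((1 - z%:P%:P * binomp u v) * geomp z u v K) 1.
Proof.
move=> z1 mK; have z0 : 1 - z != 0 by rewrite subr_eq0 eq_sym.
set Y := binomp u v - 1.
(* The product telescopes after writing 1 - z(1 + Y) = (1 - z) - z Y, leaving only the K-th power of
   Y. *)
have E : (1 - z%:P%:P * binomp u v) * geomp z u v K = 1 - ((z / (1 - z)) ^+ K)%:P%:P * Y ^+ K.
  have -> : 1 - z%:P%:P * binomp u v = (1 - z)%:P%:P - z%:P%:P * Y.
    by rewrite /Y !rmorphB !rmorph1; ring.
  rewrite /geomp -/Y; elim: (K) => [|k IHk].
    by rewrite big_ord0 mulr0 !expr0 !rmorph1 mulr1 subrr.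
  rewrite big_ord_recr /= mulrDr IHk.
  have e1 : ((z / (1 - z)) ^+ k)%:P%:P =
      (1 - z)%:P%:P * (z ^+ k / (1 - z) ^+ k.+1)%:P%:P :> {poly {poly C}}.
    rewrite -!rmorphM /=; congr (_%:P%:P); rewrite expr_div_n exprS; field.
    by rewrite ?expf_neq0 ?z0.
  have e2 : ((z / (1 - z)) ^+ k.+1)%:P%:P =
      z%:P%:P * (z ^+ k / (1 - z) ^+ k.+1)%:P%:P :> {poly {poly C}}.
    rewrite -!rmorphM /=; congr (_%:P%:P); rewrite expr_div_n exprS; field.
    by rewrite ?expf_neq0 ?z0.
  by rewrite e1 e2 [Y ^+ _.+1]exprS; set q := (_ / _)%:P%:P; ring.
rewrite E => i j iN jN; rewrite !coefB coef_scalar binomp_sub1_nilp //.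
by rewrite !coef0 mulr0 subr0.
Qed.

(* Modulo [X_1 ^ m.+1] and [X_2 ^ m.+1] each factor of the denominator is inverted
   by the finite geometric sum [geomp]. *)
Lemma Delta0_ps_div (J : Type) (r : seq J) (c x1 x2 : J -> C) (z1 z2 : C) K
    (num : pseries2 C) (den := fun z u v => ps_sub (ps_one C) (ps_scale z (ps_binomial u v))) :
  z1 != 1 -> z2 != 1 -> (m.*2.+1 <= K)%N ->
  (forall i j, num i j = \sum_(x <- r) c x * ps_binomial (x1 x) (x2 x) i j) ->
  Delta0 m (ps_div num (ps_mul (den z1 a1 a2) (den z2 b1 b2))) =
  \sum_(x <- r) c x * \sum_(j < K) z1 ^+ j / (1 - z1) ^+ j.+1 *
    \sum_(l < K) z2 ^+ l / (1 - z2) ^+ l.+1 *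
      iter l fdiff (iter j fdiff1 (norm_pow (x1 x) (x2 x)) 0%N) 0%N.
Proof.
move=> z1N1 z2N1 mK numE.
pose d1 := 1 - z1%:P%:P * binomp a1 a2; pose d2 := 1 - z2%:P%:P * binomp b1 b2.
have denP z u v : represents N (den z u v) (1 - z%:P%:P * binomp u v).
  move=> i j iN jN; rewrite !coefB -(@represents_one N) // coef_scalar.
  by rewrite -(@trunc_represents N).
set D := ps_mul _ _.
have DP : represents N D (d1 * d2) by apply: represents_mul; exact: denP.
have D0 : D 0%N 0%N != 0.
  rewrite (DP 0%N 0%N) // coefM big_ord1 coefM big_ord1 !coefB !coef_scalar !binomp00 !coef1 /=.
  by rewrite !mulr1 mulf_neq0 // subr_eq0 eq_sym.
pose V := trunc N (ps_inv D); pose n := \sum_(x <- r) (c x)%:P%:P * binomp (x1 x) (x2 x).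
have nP : represents N num n.
  move=> i j iN jN; rewrite numE /n !coef_sum; apply: eq_bigr => x _.
  by rewrite coef_scalar -(@trunc_represents N).
have DV : congr_trunc N (d1 * d2 * V) 1.
  apply: (@represents_congr N (ps_mul D (ps_inv D))).
    by apply: represents_mul => //; exact: trunc_represents.
  by move=> i j iN jN; rewrite ps_mulV // (@represents_one N).
pose Q1 := geomp z1 a1 a2 K; pose Q2 := geomp z2 b1 b2 K.
have QQ : congr_trunc N ((d1 * Q1) * (d2 * Q2)) 1.
  rewrite -[1]mulr1; apply: congr_trunc_mul; exact: geomp_inv.
have -> : Delta0 m (ps_div num D) = Delta0p m (n * Q1 * Q2).
  have FP : represents N (ps_div num D) (n * V).
    by apply: represents_mul => //; exact: trunc_represents.
  transitivity (Delta0p m (n * V)); first exact: Delta0_local.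
  apply: Delta0p_congr.
  (* First the product (d1 Q1)(d2 Q2), congruent to 1, is inserted; then d1 d2 V, also congruent to
     1, is removed. *)
  apply: (@congr_trunc_trans _ _ (n * V * ((d1 * Q1) * (d2 * Q2)))).
    rewrite -{1}[n * V]mulr1; apply: congr_trunc_mul; first exact: congr_trunc_refl.
    exact: congr_trunc_sym.
  have -> : n * V * ((d1 * Q1) * (d2 * Q2)) = n * Q1 * Q2 * (d1 * d2 * V) by ring.
  rewrite -[X in congr_trunc _ _ X]mulr1.
  by apply: congr_trunc_mul => //; exact: congr_trunc_refl.
rewrite /n !mulr_suml Delta0p_sum; apply: eq_bigr => x _.
rewrite -!mulrA Delta0p_scale; congr (_ * _).
rewrite /Q1 /geomp mulr_suml mulr_sumr Delta0p_sum; apply: eq_bigr => j _.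
have -> (P S T : {poly {poly C}}) q : P * (q%:P%:P * S * T) = q%:P%:P * (P * S * T) by ring.
rewrite Delta0p_scale; congr (_ * _).
rewrite /Q2 /geomp mulr_sumr Delta0p_sum; apply: eq_bigr => l _.
have -> (P S : {poly {poly C}}) q : P * (q%:P%:P * S) = q%:P%:P * (P * S) by ring.
rewrite Delta0p_scale; congr (_ * _).
by rewrite -Delta0p_fdiff !mul0r !addr0.
Qed.

End Evaluation.
End BivariateSeries.
(** * The zeta function of a translated lattice cone *)

Section ConeSummability.
Variable R : realType.
Implicit Types (r w x a b : R).

(** The comparison of a sum with an integral, obtained from ln (x + 1) - ln x >= 1/(x + 1) and exp t
    >= 1 + t. *)
Lemma power_telescope (rho x : R) : 0 < rho -> 0 < x ->
  expR (- (rho + 1) * ln (x + 1)) <=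
  rho^-1 * (expR (- rho * ln x) - expR (- rho * ln (x + 1))).
Proof.
move=> r0 x0; have x10 : 0 < x + 1 by rewrite addr_gt0.
set A := expR (- rho * ln (x + 1)).
have A0 : 0 < A by exact: expR_gt0.
have -> : expR (- (rho + 1) * ln (x + 1)) = A * (x + 1)^-1.
  by rewrite opprD mulrDl expRD mulN1r expRN lnK.
have -> : expR (- rho * ln x) = A * expR (rho * (ln (x + 1) - ln x)).
  by rewrite -expRD; congr expR; ring.
have lnx : (x + 1)^-1 <= ln (x + 1) - ln x.
  rewrite -lerN2 opprB -ln_div ?posrE //.
  have -> : x / (x + 1) = 1 + - (x + 1)^-1 by field; rewrite gt_eqF.
  apply: le_ln1Dx; rewrite ltrN2 invf_lt1 //; lra.
rewrite -[X in _ <= _ * (_ - X)]mulr1 -mulrBr mulrCA.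
apply: ler_wpM2l; first exact: ltW.
rewrite -(ler_pM2l r0) mulrA divff ?gt_eqF // mul1r lerBrDl.
apply: le_trans (expR_ge1Dx _); rewrite lerD2l ler_wpM2l //; exact: ltW.
Qed.

Lemma riemann_bound r : 1 < r ->
  exists B : R, forall N, \sum_(i <- iota 0 N) expR (- r * ln i.+1%:R) <= B.
Proof.
move=> r1; pose rho := r - 1; have r0 : 0 < rho by rewrite subr_gt0.
exists (1 + rho^-1) => N.
(* Keeping the telescoping remainder makes the bound inductive. *)
suff h : \sum_(i <- iota 0 N.+1) expR (- r * ln i.+1%:R) <=
    1 + rho^-1 - rho^-1 * expR (- rho * ln N.+1%:R).
  apply: (@le_trans _ _ (\sum_(i <- iota 0 N.+1) expR (- r * ln i.+1%:R))).
    by rewrite -[N.+1]addn1 iotaD big_cat /= lerDl sumr_ge0 // => i _; exact: expR_ge0.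
  apply: le_trans h _; rewrite gerBl mulr_ge0 ?expR_ge0 // invr_ge0; exact: ltW.
elim: N => [|N IHN].
  by rewrite /= big_seq1 ln1 !mulr0 expR0 mulr1 addrK.
rewrite -[N.+2]addn1 iotaD big_cat /= add0n big_seq1.
have := @power_telescope rho N.+1%:R r0 (ltr0Sn _ _).
rewrite natr1 [- (rho + 1)](_ : _ = - r); last by rewrite subrK.
move: IHN; rewrite addn1; lra.
Qed.

(** As i + j + 1 dominates both i + 1 and j + 1, the term is at most (i+1)^(-r/2) (j+1)^(-r/2); a
    square containing the finite set then gives a product of two convergent sums. *)
Lemma abs_summ_cone r : 2 < r ->
  abs_summ (fun ij : nat * nat => (expR (- r * ln (ij.1 + ij.2).+1%:R))%:C : R[i]).
Proof.
move=> r2; have [|B hB] := @riemann_bound (r / 2); first by lra.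
exists (B * B) => s us; pose N := (\max_(ij <- s) (ij.1 + ij.2)).+1.
pose e (i : nat) : R := expR (- (r / 2) * ln i.+1%:R).
have e0 i : 0 <= e i by exact: expR_ge0.
apply: (@le_trans _ _ (\sum_(ij <- s) e ij.1 * e ij.2)).
  apply: ler_sum => -[i j] _ /=; rewrite modulus_real ger0_norm ?expR_ge0 //.
  rewrite -expRD ler_expR.
  have l1 : ln i.+1%:R <= ln (i + j).+1%:R :> R.
    by rewrite ler_ln ?posrE ?ltr0Sn // ler_nat ltnS leq_addr.
  have l2 : ln j.+1%:R <= ln (i + j).+1%:R :> R.
    by rewrite ler_ln ?posrE ?ltr0Sn // ler_nat ltnS leq_addl.
  by move: (ln i.+1%:R) (ln j.+1%:R) (ln (i + j).+1%:R) l1 l2 => X Y Z l1 l2; nra.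
apply: (@le_trans _ _ (\sum_(ij <- allpairs pair (iota 0 N) (iota 0 N)) e ij.1 * e ij.2)).
  apply: sum_subset_le => //.
  - by move=> t; rewrite mulr_ge0.
  - by apply: allpairs_uniq; rewrite ?iota_uniq // => -[? ?] [? ?].
  - move=> [i j] ij.
    have lt : (i + j < N)%N.
      rewrite ltnS; pose g (ij : nat * nat) := (ij.1 + ij.2)%N.
      by apply: (@leq_bigmax_seq _ s xpredT g (i, j)).
    apply/allpairsP; exists (i, j); rewrite !mem_iota !add0n /=; split=> //.
      exact: leq_ltn_trans (leq_addr _ _) lt.
    exact: leq_ltn_trans (leq_addl _ _) lt.
have S0 : 0 <= \sum_(i <- iota 0 N) e i by apply: sumr_ge0.
rewrite big_allpairs (eq_bigr (fun i => e i * \sum_(j <- iota 0 N) e j)); last first.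
  by move=> i _; rewrite mulr_sumr.
by rewrite -mulr_suml; apply: ler_pM => //; exact: hB.
Qed.

(** The constant dominates x, a, b and their inverses. Every larger M also works, so that one M can
    serve both embeddings. *)
Lemma comparable_linear x a b : 0 < x -> 0 < a -> 0 < b ->
  exists2 M0, 1 <= M0 & forall M, M0 <= M -> forall i j : nat,
    comparable_to (i + j).+1%:R M (x + i%:R * a + j%:R * b).
Proof.
move=> x0 a0 b0; exists (1 + (x + a + b) + (x^-1 + a^-1 + b^-1)).
  by rewrite -addrA lerDl !addr_ge0 // ?invr_ge0 ltW.
move=> M; have [xi ai bi] : [/\ 0 < x^-1, 0 < a^-1 & 0 < b^-1] by rewrite !invr_gt0.
move=> hM i j; have i0 : 0 <= i%:R :> R by []. have j0 : 0 <= j%:R :> R by [].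
have Mx : 1 <= M * x by rewrite -(mulVf (lt0r_neq0 x0)) ler_wpM2r ?ltW //; lra.
have Ma : 1 <= M * a by rewrite -(mulVf (lt0r_neq0 a0)) ler_wpM2r ?ltW //; lra.
have Mb : 1 <= M * b by rewrite -(mulVf (lt0r_neq0 b0)) ler_wpM2r ?ltW //; lra.
rewrite -natr1 natrD; split.
  have -> : M * (x + i%:R * a + j%:R * b) = i%:R * (M * a) + j%:R * (M * b) + M * x by ring.
  by apply: lerD => //; apply: lerD; rewrite ler_peMr.
have -> : M * (i%:R + j%:R + 1) = M + i%:R * M + j%:R * M by ring.
by apply: lerD; [apply: lerD|]; rewrite ?ler_wpM2l //; lra.
Qed.

End ConeSummability.

(** * Complex differentiability of sums depending on a parameter *)

Section ComplexDifferentiability.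
Variable R : realType.
Implicit Types (f g : R[i] -> R[i]) (s h : R[i]).

(** A quadratic error bound on the whole unit disc is stronger than derivability, and it passes to
    infinite sums by adding the constants. *)
Definition cdiff f s : Prop := exists d (B : R), forall h, modulus h <= 1 ->
  modulus (f (s + h) - f s - h * d) <= B * modulus h ^+ 2.

Lemma cdiff_derivable f s : cdiff f s -> derivable (f : R[i]^o -> R[i]^o) s 1.
Proof.
move=> [d [B hB]]; apply/cvg_ex; exists d; apply/(@cvgrPdist_lt _ R[i]^o) => e e0.
have er : e = (complex.Re e)%:C by rewrite RRe_real // gtr0_real.
have er0 : 0 < complex.Re e by rewrite -ltcR -er.
have B1 : 0 < `|B| + 1 by rewrite ltr_wpDl.
near=> h.
have h0 : h != 0 by near: h; exact: nbhs_dnbhs_neq.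
have h1 : modulus h < 1.
  by rewrite -ltcR -modulusE; near: h; apply: dnbhs0_lt; rewrite ltcR.
have he : modulus h < complex.Re e / (`|B| + 1).
  by rewrite -ltcR -modulusE; near: h; apply: dnbhs0_lt; rewrite ltcR divr_gt0.
have mh0 : 0 < modulus h by rewrite lt_neqAle eq_sym modulus_eq0 h0 modulus_ge0.
rewrite er modulusE ltcR /= {1}/GRing.scale /= [h *: 1]mulr1 [h + s]addrC modulusB.
have -> : h^-1 * (f (s + h) - f s) - d = h^-1 * (f (s + h) - f s - h * d).
  by rewrite [RHS]mulrBr mulKf.
rewrite modulusM.
have mV : modulus h^-1 = (modulus h)^-1.
  apply: (mulfI (lt0r_neq0 mh0)); rewrite -modulusM divff // modulus1.
  by rewrite divff // lt0r_neq0.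
rewrite mV mulrC ltr_pdivrMr //.
apply: le_lt_trans (hB h (ltW h1)) _.
apply: (@le_lt_trans _ _ ((`|B| + 1) * modulus h ^+ 2)).
  by rewrite ler_wpM2r ?exprn_ge0 ?modulus_ge0 // (le_trans (ler_norm _)) // lerDl.
by rewrite expr2 mulrA ltr_pM2r // mulrC -ltr_pdivlMr.
Unshelve. all: by end_near.
Qed.

(** [analytic_at] asks for derivability near the point, which derivability everywhere provides. *)
Lemma cdiff_analytic f : (forall s, cdiff f s) -> forall s, analytic_at f s.
Proof. by move=> fd s; near=> z; exact: cdiff_derivable. Unshelve. all: by end_near. Qed.

Lemma cdiffD f g s : cdiff f s -> cdiff g s -> cdiff (fun z => f z + g z) s.
Proof.
move=> [d [B hB]] [d' [B' hB']]; exists (d + d'), (B + B') => h h1.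
have -> : f (s + h) + g (s + h) - (f s + g s) - h * (d + d') =
  (f (s + h) - f s - h * d) + (g (s + h) - g s - h * d') by ring.
by rewrite mulrDl; apply: modulusD_le; [exact: hB|exact: hB'].
Qed.

Lemma cdiffZ c f s : cdiff f s -> cdiff (fun z => c * f z) s.
Proof.
move=> [d [B hB]]; exists (c * d), (modulus c * B) => h h1.
have -> : c * f (s + h) - c * f s - h * (c * d) = c * (f (s + h) - f s - h * d) by ring.
by rewrite modulusM -mulrA ler_wpM2l ?modulus_ge0 // hB.
Qed.

Lemma cdiffB f g s : cdiff f s -> cdiff g s -> cdiff (fun z => f z - g z) s.
Proof.
move=> fd /(cdiffZ (-1)) gd; have := cdiffD fd gd.
by congr cdiff; apply/funext => z; rewrite mulN1r.
Qed.

Lemma cdiff0 s : cdiff (fun=> 0) s.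
Proof. by exists 0, 0 => h _; rewrite mulr0 !subr0 modulus0 mul0r. Qed.

Lemma cdiff_sum (J : eqType) (r : seq J) (F : J -> R[i] -> R[i]) s :
  {in r, forall x, cdiff (F x) s} -> cdiff (fun z => \sum_(x <- r) F x z) s.
Proof.
elim: r => [_|x r IHr Fd].
  by under eq_fun do rewrite big_nil; exact: cdiff0.
have {}IHr := IHr (fun i ir => Fd i (@mem_behead _ (x :: r) i ir)).
by under eq_fun do rewrite big_cons; apply: cdiffD => //; apply: Fd; exact: mem_head.
Qed.

Lemma cdiff_local f g s : (forall h, modulus h <= 1 -> f (s + h) = g (s + h)) ->
  cdiff f s -> cdiff g s.
Proof.
move=> fg [d [B hB]]; exists d, B => h h1; rewrite -fg // -[g s](_ : f s = _).
  exact: hB.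
by rewrite -[s]addr0 fg // modulus0.
Qed.

(* A summable family differentiable in z with a summable quadratic error term; this
   replaces the theorem that a locally uniform limit of holomorphic functions is
   holomorphic. *)
Definition dsummable (T : eqType) (u : R[i] -> T -> R[i]) s : Prop :=
  exists v m : T -> R[i], [/\ abs_summ (u s), abs_summ v, abs_summ m &
    forall h, modulus h <= 1 -> forall t,
      modulus (u (s + h) t - u s t - h * v t) <= modulus h ^+ 2 * modulus (m t)].

Lemma dsummable_ext (T : eqType) (u u' : R[i] -> T -> R[i]) s :
  (forall z t, u z t = u' z t) -> dsummable u s -> dsummable u' s.
Proof. by move=> uu; rewrite (_ : u = u') //; apply/funext => z; apply/funext. Qed.

Lemma dsummableB (T : eqType) (u u' : R[i] -> T -> R[i]) s :
  dsummable u s -> dsummable u' s -> dsummable (fun z t => u z t - u' z t) s.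
Proof.
move=> [v [m [su sv sm hm]]] [v' [m' [su' sv' sm' hm']]].
exists (fun t => v t - v' t), (fun t => (modulus (m t))%:C + (modulus (m' t))%:C).
split; try exact: abs_summB.
  by apply: abs_summD; [apply: abs_summ_le sm|apply: abs_summ_le sm'] => t;
    rewrite -[leLHS]mul1r modulus_real ger0_norm ?modulus_ge0.
move=> h h1 t.
have -> : u (s + h) t - u' (s + h) t - (u s t - u' s t) - h * (v t - v' t) =
  (u (s + h) t - u s t - h * v t) - (u' (s + h) t - u' s t - h * v' t) by ring.
rewrite -rmorphD modulus_real ger0_norm ?addr_ge0 ?modulus_ge0 // mulrDr.
by apply: modulusD_le; [exact: hm|rewrite modulusN; exact: hm'].
Qed.

Lemma dsummable_twist (T : eqType) (c : T -> R[i]) (u : R[i] -> T -> R[i]) s :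
  (forall t, modulus (c t) <= 1) ->
  dsummable u s -> dsummable (fun z t => c t * u z t) s.
Proof.
move=> c1 [v [m [su sv sm hm]]].
have le t z : modulus (c t * z) <= 1 * modulus z.
  by rewrite modulusM ler_wpM2r ?modulus_ge0.
exists (fun t => c t * v t), m; split=> //.
- by apply: abs_summ_le su => t; exact: le.
- by apply: abs_summ_le sv => t; exact: le.
move=> h h1 t.
have -> : c t * u (s + h) t - c t * u s t - h * (c t * v t) =
  c t * (u (s + h) t - u s t - h * v t) by ring.
by apply: le_trans (le _ _) _; rewrite mul1r; exact: hm.
Qed.

Lemma dsummable_cdiff (T : eqType) (u : R[i] -> T -> R[i]) s :
  dsummable u s -> cdiff (fun z => tsum (u z)) s.
Proof.
move=> [v [m [su sv sm hm]]]; have [B hB] := sm.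
exists (tsum v), B => h h1.
pose q t := u (s + h) t - u s t - h * v t.
have sq : abs_summ q by apply: abs_summ_le sm => t; exact: hm.
have hv := has_sumZ h (tsumP sv).
have uE t : u (s + h) t = q t + (u s t + h * v t) by rewrite /q; ring.
have -> : tsum (u (s + h)) - tsum (u s) - h * tsum v = tsum q.
  have -> : tsum (u (s + h)) = tsum q + (tsum (u s) + h * tsum v).
    apply: tsumE; apply: has_sum_ext (has_sumD (tsumP sq) (has_sumD (tsumP su) hv)).
    by move=> t; rewrite uE.
  by ring.
apply: tsum_bound => r ur; rewrite mulrC.
apply: (@le_trans _ _ (\sum_(t <- r) modulus h ^+ 2 * modulus (m t))).
  by apply: ler_sum => t _; exact: hm.
by rewrite -mulr_sumr ler_wpM2l ?exprn_ge0 ?modulus_ge0 // hB.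
Qed.

End ComplexDifferentiability.

(** * Differences of norm powers as functions of s *)

Section ConeDifferences.
Variable R : realType.
Implicit Types (s h : R[i]) (w y : R).
Local Notation fdiff := (@fdiff R[i]).

Definition logpow_fdiff K (a1 a2 : R) j s (y1 y2 : R) : R[i] :=
  iter K fdiff (fun n => logpow (- s) (- s) j (y1 + n%:R * a1) (y2 + n%:R * a2)) 0%N.

Variables (K : nat) (a1 a2 M : R).
Hypotheses (a10 : 0 <= a1) (a20 : 0 <= a2) (M1 : 1 <= M).

Lemma logpow_fdiff_bound j s : exists2 B : R, 0 <= B & forall w y1 y2, 1 <= w ->
  comparable_to w M y1 -> comparable_to w M y2 ->
  modulus (logpow_fdiff K a1 a2 j s y1 y2) <=
    B * expR (- (complex.Re s *+ 2 + K%:R - j%:R) * ln w).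
Proof.
have [B B0 hB] := @fdiff_logpow_bound R K j (modulus s) M a1 a2 (modulus_ge0 s) M1 a10 a20.
exists B => // w y1 y2 w1 c1 c2.
have -> : - (complex.Re s *+ 2 + K%:R - j%:R) =
    complex.Re (- s) + complex.Re (- s) + j%:R - K%:R by rewrite ReN; ring.
by apply: hB; rewrite ?modulusN.
Qed.

(** Taylor's bound along the segment from s to s + h. Of the four lost powers of w, two come from
    the squared logarithm in the second derivative and two from moving s in both exponents by at
    most 1. *)
Lemma logpow_fdiff_taylor s : exists2 B : R, 0 <= B & forall h w y1 y2,
  modulus h <= 1 -> 1 <= w -> comparable_to w M y1 -> comparable_to w M y2 ->
  modulus (logpow_fdiff K a1 a2 0 (s + h) y1 y2 - logpow_fdiff K a1 a2 0 s y1 y2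
           - h * (- logpow_fdiff K a1 a2 1 s y1 y2)) <=
  modulus h ^+ 2 * (B * expR (- (complex.Re s *+ 2 + K%:R - 4) * ln w)).
Proof.
have N0 : 0 <= modulus s + 1 by rewrite addr_ge0 ?modulus_ge0.
have [B B0 hB] := @fdiff_logpow_bound R K 2 (modulus s + 1) M a1 a2 N0 M1 a10 a20.
exists (B *+ 4); first by rewrite mulrn_wge0.
move=> h w y1 y2 h1 w1 c1 c2.
pose F j (t : R) := iter K fdiff (fun n =>
  logpow (- s + t%:C * - h) (- s + t%:C * - h) j (y1 + n%:R * a1) (y2 + n%:R * a2)) 0%N.
have F0 j : F j 0 = logpow_fdiff K a1 a2 j s y1 y2.
  by rewrite /F mul0r addr0.
have F1 : F 0%N 1 = logpow_fdiff K a1 a2 0 (s + h) y1 y2.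
  by rewrite /F mul1r -opprD.
have Fd j t : is_cderive (F j) t (- h * F j.+1 t).
  rewrite /F -iter_fdiffZ; apply: is_cderive_fdiff => n.
  exact: is_cderive_logpow_exponent.
rewrite mulrN -mulNr -F1 -!F0.
set E := expR _.
have -> : modulus h ^+ 2 * (B *+ 4 * E) = (modulus h ^+ 2 * (B * E)) *+ 4.
  by rewrite mulrnAl mulrnAr.
apply: (@taylor2_bound _ (F 0%N) (fun t => - h * F 1%N t) (fun t => - h * (- h * F 2%N t))).
- by move=> t _; exact: Fd.
- by move=> t _; apply: is_cderiveZ; exact: Fd.
move=> t /andP[t0 t1].
rewrite mulrA modulusM -expr2 modulusX modulusN ler_wpM2l ?exprn_ge0 ?modulus_ge0 //.
have mth : modulus (t%:C * - h) <= 1.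
  by rewrite modulusM modulusN modulus_real ger0_norm // mulr_ile1 ?modulus_ge0.
have mN : modulus (- s + t%:C * - h) <= modulus s + 1.
  by apply: modulusD_le; rewrite ?modulusN.
apply: le_trans (hB _ _ _ _ _ mN mN w1 c1 c2) _.
rewrite ler_wpM2l // ler_expR ler_wpM2r ?ln_ge0 //.
have := le_trans (Re_le_modulus _) mth; rewrite ler_norml => /andP[_].
by rewrite ReD ReN; lra.
Qed.

Variables (T : eqType) (W Y1 Y2 : T -> R).
Hypotheses (W1 : forall t, 1 <= W t) (W_summ : forall r : R, 2 < r ->
  abs_summ (fun t => (expR (- r * ln (W t)))%:C : R[i])).
Hypotheses (WY1 : forall t, comparable_to (W t) M (Y1 t))
  (WY2 : forall t, comparable_to (W t) M (Y2 t)).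

Lemma abs_summ_logpow_fdiff j s : 2 < complex.Re s *+ 2 + K%:R - j%:R ->
  abs_summ (fun t => logpow_fdiff K a1 a2 j s (Y1 t) (Y2 t)).
Proof.
move=> hs; have [B B0 hB] := logpow_fdiff_bound j s.
apply: abs_summ_le (W_summ hs) => t.
by rewrite modulus_real ger0_norm ?expR_ge0 //; exact: hB.
Qed.

(** The threshold 6 is the 2 needed for summability over the cone plus the 4 lost in the Taylor
    estimate. *)
Lemma dsummable_logpow_fdiff s : 6 < complex.Re s *+ 2 + K%:R ->
  dsummable (fun z t => logpow_fdiff K a1 a2 0 z (Y1 t) (Y2 t)) s.
Proof.
move=> hs; have [B B0 hB] := logpow_fdiff_taylor s.
exists (fun t => - logpow_fdiff K a1 a2 1 s (Y1 t) (Y2 t)).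
exists (fun t => B%:C * (expR (- (complex.Re s *+ 2 + K%:R - 4) * ln (W t)))%:C).
split.
- by apply: abs_summ_logpow_fdiff; lra.
- by apply: abs_summN; apply: abs_summ_logpow_fdiff; lra.
- by apply: abs_summZ; apply: W_summ; lra.
move=> h h1 t; rewrite -rmorphM modulus_real ger0_norm ?mulr_ge0 ?expR_ge0 //.
exact: hB.
Qed.

End ConeDifferences.

(** * Continuation and special values for one translate of the lattice cone *)

Section ConeZeta.
Variable R : realType.
Variables (x1 x2 a1 a2 b1 b2 : R) (z1 z2 : R[i]).
Hypotheses (x10 : 0 < x1) (x20 : 0 < x2) (a10 : 0 < a1) (a20 : 0 < a2)
  (b10 : 0 < b1) (b20 : 0 < b2).
Hypotheses (z1_le1 : modulus z1 <= 1) (z2_le1 : modulus z2 <= 1)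
  (z1_neq1 : z1 != 1) (z2_neq1 : z2 != 1).
Implicit Types (s h : R[i]) (K l i j : nat).
Local Notation fdiff := (@fdiff R[i]).
Local Notation fdiff1 := (@fdiff1 R[i]).

Let y1 i j : R := x1 + i%:R * a1 + j%:R * b1.
Let y2 i j : R := x2 + i%:R * a2 + j%:R * b2.

Definition cone_term s i j : R[i] :=
  logpow (- s) (- s) 0 (x1 + i%:R * a1 + j%:R * b1) (x2 + i%:R * a2 + j%:R * b2).

(** This weight replaces the distance to the origin: both embeddings of the lattice point are
    comparable to it. *)
Let W (ij : nat * nat) : R := (ij.1 + ij.2).+1%:R.

Let W1 ij : 1 <= W ij. Proof. by rewrite /W ler1n. Qed.

Let exM : exists M, [/\ 1 <= M, forall ij, comparable_to (W ij) M (y1 ij.1 ij.2) &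
  forall ij, comparable_to (W ij) M (y2 ij.1 ij.2)].
Proof.
have [M M1 hM] := comparable_linear x10 a10 b10.
have [M' M1' hM'] := comparable_linear x20 a20 b20.
exists (M + M'); split; first by rewrite (le_trans M1) // lerDl (le_trans _ M1').
  by move=> ij; apply: hM; rewrite lerDl (le_trans _ M1').
by move=> ij; apply: hM'; rewrite lerDr (le_trans _ M1).
Qed.

Let fdiff1_cone K s i j : iter K fdiff1 (cone_term s) i j =
  logpow_fdiff K a1 a2 0 s (y1 i j) (y2 i j).
Proof.
rewrite iter_fdiff1E -[i in LHS]add0n -iter_fdiff_shift /logpow_fdiff.
apply: iter_fdiff_ext => n; rewrite /cone_term /y1 /y2 natrD.
have E (x a b : R) : x + (n%:R + i%:R) * a + j%:R * b =
  x + i%:R * a + j%:R * b + n%:R * a by ring.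
by rewrite !E.
Qed.

Let fdiff_cone K s i j : iter K fdiff (cone_term s i) j =
  logpow_fdiff K b1 b2 0 s (y1 i j) (y2 i j).
Proof.
rewrite -[j in LHS]add0n -iter_fdiff_shift /logpow_fdiff.
apply: iter_fdiff_ext => n; rewrite /cone_term /y1 /y2 natrD.
have E (x a b : R) : x + i%:R * a + (n%:R + j%:R) * b =
  x + i%:R * a + j%:R * b + n%:R * b by ring.
by rewrite !E.
Qed.

Let row_inj i : injective (fun j : nat => (i, j)).
Proof. by move=> j j' []. Qed.

Lemma abs_summ_fdiff1_cone K s : 2 < complex.Re s *+ 2 + K%:R ->
  abs_summ (fun ij : nat * nat => iter K fdiff1 (cone_term s) ij.1 ij.2).
Proof.
move=> hs; have [M [M1 c1 c2]] := exM.
under eq_fun do rewrite fdiff1_cone.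
apply: (abs_summ_logpow_fdiff (ltW a10) (ltW a20) M1 W1 (@abs_summ_cone R) c1 c2).
by rewrite subr0.
Qed.

(** Only the differences in j supply decay; each further difference in i subtracts two summable
    rows. *)
Lemma abs_summ_fdiff_cone K l s i : 2 < complex.Re s *+ 2 + K%:R ->
  abs_summ (iter K fdiff (iter l fdiff1 (cone_term s) i)).
Proof.
move=> hs; have [M [M1 c1 c2]] := exM; elim: l i => [|l IHl] i.
  rewrite (_ : iter K _ _ = fun j => logpow_fdiff K b1 b2 0 s (y1 i j) (y2 i j)); last first.
    by apply/funext => j; rewrite fdiff_cone.
  apply: (abs_summ_comp (@row_inj i)
    (u := fun ij => logpow_fdiff K b1 b2 0 s (y1 ij.1 ij.2) (y2 ij.1 ij.2))).
  apply: (abs_summ_logpow_fdiff (ltW b10) (ltW b20) M1 W1 (@abs_summ_cone R) c1 c2).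
  by rewrite subr0.
rewrite (_ : iter K _ _ = fun j => iter K fdiff (iter l fdiff1 (cone_term s) i.+1) j -
  iter K fdiff (iter l fdiff1 (cone_term s) i) j); first exact: abs_summB.
by apply/funext => j; rewrite -iter_fdiffB.
Qed.

Lemma dsummable_fdiff_cone K l s i : 6 < complex.Re s *+ 2 + K%:R ->
  dsummable (fun z => iter K fdiff (iter l fdiff1 (cone_term z) i)) s.
Proof.
move=> hs; have [M [M1 c1 c2]] := exM; elim: l i => [|l IHl] i.
  apply: (@dsummable_ext _ _ (fun z j => logpow_fdiff K b1 b2 0 z (y1 i j) (y2 i j))).
    by move=> z j; rewrite -fdiff_cone.
  apply: (@dsummable_logpow_fdiff R K b1 b2 M (ltW b10) (ltW b20) M1 _
    (fun j => W (i, j)) (y1 i) (y2 i)) => //.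
  by move=> r r2; apply: (abs_summ_comp (@row_inj i)) (abs_summ_cone r2).
apply: dsummable_ext (dsummableB (IHl i.+1) (IHl i)) => z j.
by rewrite -iter_fdiffB.
Qed.

(** A difference at a fixed point is a finite combination of norm powers, so the Taylor bound of
    order K = 0 suffices, with no condition on s. *)
Lemma cdiff_cone l l' s i j :
  cdiff (fun z => iter l' fdiff (iter l fdiff1 (cone_term z) i) j) s.
Proof.
elim: l' j => [|l' IHl'] j; last exact: cdiffB (IHl' j.+1) (IHl' j).
elim: l i => [|l IHl] i; last exact: cdiffB (IHl i.+1) (IHl i).
have [M [M1 c1 c2]] := exM.
have [B B0 hB] := @logpow_fdiff_taylor R 0 a1 a2 M (ltW a10) (ltW a20) M1 s.
exists (- logpow_fdiff 0 a1 a2 1 s (y1 i j) (y2 i j)).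
exists (B * expR (- (complex.Re s *+ 2 + 0%:R - 4) * ln (W (i, j)))) => h h1.
have E z : cone_term z i j = logpow_fdiff 0 a1 a2 0 z (y1 i j) (y2 i j).
  by rewrite -fdiff1_cone.
by rewrite /= !E [leRHS]mulrC; apply: hB; [|exact: W1|exact: (c1 (i, j))|exact: (c2 (i, j))].
Qed.

Lemma cdiff_reg2_cone K s : 6 < complex.Re s *+ 2 + K%:R ->
  cdiff (fun z => reg2 z1 z2 K (cone_term z)) s.
Proof.
move=> hs; rewrite /reg2; apply: cdiffD.
  apply: (@cdiff_sum _ _ _ (fun (l : 'I_K) z =>
    z1 ^+ l / (1 - z1) ^+ l.+1 * reg z2 K (iter l fdiff1 (cone_term z) 0%N))) => l _.
  apply: cdiffZ; rewrite /reg; apply: cdiffD.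
    apply: (@cdiff_sum _ _ _ (fun (l' : 'I_K) z => z2 ^+ l' / (1 - z2) ^+ l'.+1 *
      iter l' fdiff (iter l fdiff1 (cone_term z) 0%N) 0%N)) => l' _.
    by apply: cdiffZ; exact: cdiff_cone.
  apply: cdiffZ; apply: dsummable_cdiff; apply: dsummable_twist.
    by move=> n; rewrite modulusX exprn_ile1 ?modulus_ge0.
  exact: dsummable_fdiff_cone.
apply: cdiffZ; apply: dsummable_cdiff; apply: dsummable_twist.
  by move=> ij; rewrite modulusM !modulusX mulr_ile1 ?exprn_ge0 ?exprn_ile1 ?modulus_ge0.
have [M [M1 c1 c2]] := exM.
apply: (@dsummable_ext _ _ (fun z ij => logpow_fdiff K a1 a2 0 z (y1 ij.1 ij.2) (y2 ij.1 ij.2))).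
  by move=> z ij; rewrite -fdiff1_cone.
exact: (dsummable_logpow_fdiff (ltW a10) (ltW a20) M1 W1 (@abs_summ_cone R) c1 c2 hs).
Qed.

Lemma reg2_cone_stable K K' s : 2 < complex.Re s *+ 2 + K%:R -> (K <= K')%N ->
  reg2 z1 z2 K' (cone_term s) = reg2 z1 z2 K (cone_term s).
Proof.
move=> hs; elim: K' => [|K' IHK]; first by rewrite leqn0 => /eqP ->.
rewrite leq_eqVlt => /predU1P[-> //|]; rewrite ltnS => KK'.
have hs' : 2 < complex.Re s *+ 2 + K'%:R.
  by apply: lt_le_trans hs _; rewrite lerD2l ler_nat.
rewrite reg2_step ?IHK //; last exact: abs_summ_fdiff1_cone.
by move=> l; exact: abs_summ_fdiff_cone.
Qed.

(* Any order [K] with [2 Re s + K > 2] gives the same value. *)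
Definition cone_order s : nat := Num.bound (`|6 - complex.Re s *+ 2|).

Lemma cone_orderP s : 6 < complex.Re s *+ 2 + (cone_order s)%:R.
Proof.
have := archi_boundP (normr_ge0 (6 - complex.Re s *+ 2)).
by move=> /(le_lt_trans (ler_norm _)); rewrite -/(cone_order s); lra.
Qed.

Definition cone_zeta s : R[i] := reg2 z1 z2 (cone_order s) (cone_term s).

Lemma cone_zetaE K s : 2 < complex.Re s *+ 2 + K%:R ->
  cone_zeta s = reg2 z1 z2 K (cone_term s).
Proof.
move=> hs; have hK := cone_orderP s; have hK2 : 2 < complex.Re s *+ 2 + (cone_order s)%:R by lra.
case/orP: (leq_total K (cone_order s)) => KK; first exact: reg2_cone_stable.
by rewrite [RHS](reg2_cone_stable hK2).
Qed.

Lemma cone_zeta_cdiff s : cdiff cone_zeta s.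
Proof.
(* Moving s by at most 1 lowers 2 Re s by at most 2, so this one order serves on the whole unit disc
   around s. *)
pose K := (cone_order s + 2)%N.
have hK : 8 < complex.Re s *+ 2 + K%:R by have := cone_orderP s; rewrite /K natrD; lra.
apply: (@cdiff_local _ (fun z => reg2 z1 z2 K (cone_term z))); last first.
  by apply: cdiff_reg2_cone; lra.
move=> h h1; apply/esym/cone_zetaE.
have := le_trans (Re_le_modulus h) h1; rewrite ler_norml => /andP[h2 _].
by rewrite ReD; lra.
Qed.

Lemma abs_summ_cone_term s : 1 < complex.Re s ->
  abs_summ (fun ij : nat * nat => cone_term s ij.1 ij.2).
Proof. by move=> s1; apply: (@abs_summ_fdiff1_cone 0); lra. Qed.

Lemma cone_zeta_sum s : 1 < complex.Re s -> cone_zeta s =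
  tsum (fun ij : nat * nat => z1 ^+ ij.1 * z2 ^+ ij.2 * cone_term s ij.1 ij.2).
Proof.
move=> s1; rewrite (@cone_zetaE 0); last by lra.
by rewrite /reg2 big_ord0 add0r expr0 mul1r.
Qed.

Lemma cone_term_nonpos (m : nat) : cone_term (- m%:R) =
  norm_pow m a1%:C a2%:C b1%:C b2%:C x1%:C x2%:C.
Proof.
apply/funext => i; apply/funext => j; have [M [M1 c1 c2]] := exM.
have [p1 _] := ln_comparable (W1 (i, j)) M1 (c1 (i, j)).
have [p2 _] := ln_comparable (W1 (i, j)) M1 (c2 (i, j)).
rewrite /= in p1 p2; rewrite /cone_term -/(y1 i j) -/(y2 i j) /logpow expr0 mulr1 opprK.
have -> : norm_pow m a1%:C a2%:C b1%:C b2%:C x1%:C x2%:C i j = ((y1 i j * y2 i j) ^+ m)%:C.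
  by rewrite /norm_pow rmorphXn rmorphM /y1 /y2 !rmorphD !rmorphM !rmorph_nat.
have -> : m%:R * (ln (y1 i j))%:C + m%:R * (ln (y2 i j))%:C =
    (m%:R * (ln (y1 i j) + ln (y2 i j)))%:C :> R[i].
  by rewrite rmorphM rmorphD rmorph_nat /= mulrDr.
by rewrite cexp_real expRM_natl expRD !lnK // posrE.
Qed.

(** The first bound on K makes the regularization of order K compute the continuation; the second
    makes its infinite tails vanish. *)
Lemma cone_zeta_nonpos (m K : nat) : (cone_order (- m%:R) <= K)%N -> (m.*2.+1 <= K)%N ->
  cone_zeta (- m%:R) = \sum_(j < K) z1 ^+ j / (1 - z1) ^+ j.+1 *
    \sum_(l < K) z2 ^+ l / (1 - z2) ^+ l.+1 *
      iter l fdiff (iter j fdiff1 (norm_pow m a1%:C a2%:C b1%:C b2%:C x1%:C x2%:C) 0%N) 0%N.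
Proof.
move=> oK mK; rewrite (@cone_zetaE K); last first.
  have := cone_orderP (- m%:R); have : (cone_order (- m%:R))%:R <= K%:R :> R by rewrite ler_nat.
  by lra.
have tsum0 (T : eqType) (u : T -> R[i]) : u =1 (fun=> 0) -> tsum u = 0.
  by move=> /funext ->; apply: tsumE; exact: has_sum0.
rewrite /reg2 cone_term_nonpos [X in _ + _ * X]tsum0 ?mulr0 ?addr0; last first.
  by move=> ij; rewrite fdiff1_norm_pow0 // mulr0.
apply: eq_bigr => j _; congr (_ * _); rewrite /reg [X in _ + _ * X]tsum0 ?mulr0 ?addr0 //.
by move=> n; rewrite fdiff_norm_pow0 // mulr0.
Qed.

End ConeZeta.
(** * The partial zeta function *)

Section ShintaniCone.
Variables (R : realType) (k : fieldExtType rat).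
Hypothesis k_quadratic : \dim {:k}%VS = 2%N.
Variables (iota1 iota2 : {rmorphism k -> R}).
Hypothesis iota_neq : exists x, iota1 x <> iota2 x.
Variables (I : set k) (xi : k -> R[i]).
Hypotheses (I_frac : fractional_ideal I) (xi_char : additive_character xi I).
Variables (f : nat).
Hypothesis f_gt0 : (0 < f)%N.
Hypothesis f_gen :
  [set n : int | annihilator xi I n%:~R] = [set n | (f%:Z %| n)%Z].
Variables (tau1 tau2 : k).
Hypotheses (It1 : I tau1) (It2 : I tau2) (tau_free : free [:: tau1; tau2]).
Hypotheses (tau11 : 0 < iota1 tau1) (tau12 : 0 < iota2 tau1)
  (tau21 : 0 < iota1 tau2) (tau22 : 0 < iota2 tau2).
Variable p : nat.
Hypotheses (p_prime : prime p) (p_coprime : coprime_ideal p (annihilator xi I)).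
Implicit Types (a x y : k) (s : R[i]).

Let p0 : (p%:R != 0 :> rat).
Proof. by rewrite pnatr_eq0 -lt0n prime_gt0. Qed.
Let pR : 0 < p%:R :> R.
Proof. by rewrite ltr0n prime_gt0. Qed.
Let pQ : 0 < p%:R :> rat.
Proof. by rewrite ltr0n prime_gt0. Qed.

Let xiD a b : I a -> I b -> xi (a + b) = xi a * xi b.
Proof. by case: xi_char => + _; apply. Qed.

Let I0 : I 0 := ideal0 I_frac It1.

Lemma xi_neq0 a : I a -> xi a != 0.
Proof.
move=> Ia; have [_ /(_ a Ia)[n n0 /unity_rootP xn]] := xi_char.
apply/eqP => x0; move: xn; rewrite x0 expr0n gtn_eqF // => /eqP.
by rewrite eq_sym oner_eq0.
Qed.

Lemma xi0 : xi 0 = 1.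
Proof.
by apply: (mulfI (xi_neq0 I0)); rewrite -xiD // addr0 mulr1.
Qed.

Lemma xi_nat (n : nat) a : I a -> xi (n%:R * a) = xi a ^+ n.
Proof.
move=> Ia; elim: n => [|n IHn]; first by rewrite mul0r xi0.
by rewrite -natr1 mulrDl mul1r xiD ?IHn ?exprSr //; exact: ideal_nat.
Qed.

Lemma modulus_xi a : I a -> modulus (xi a) = 1.
Proof.
move=> Ia; have [_ /(_ a Ia)[n n0 /unity_rootP xn]] := xi_char.
apply/eqP; rewrite -(@pexpr_eq1 _ _ n) ?modulus_ge0 //.
by rewrite -modulusX xn modulus1.
Qed.

Lemma xi_unity a : I a -> f.-unity_root (xi a).
Proof.
move=> Ia; apply/unity_rootP; rewrite -xi_nat //.
have : [set n : int | annihilator xi I n%:~R] f%:Z by rewrite f_gen /= dvdzz.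
by case=> _; apply.
Qed.

(** If f = g p, write 1 = p a + b with b in the annihilator. Then g x = f (a x) + b (g x) is killed
    by the character, so f divides the smaller positive integer g. *)
Lemma coprime_p_f : coprime p f.
Proof.
rewrite prime_coprime //; apply/negP => /dvdnP[g fE].
have : (@integers k) 1 by exact: integers1.
rewrite -p_coprime => -[a Oa [b [Ob xib] ab]].
have : [set n : int | annihilator xi I n%:~R] g%:Z.
  split; first exact: integers_int.
  move=> x Ix.
  have -> : g%:Z%:~R * x = f%:R * (a * x) + b * (g%:R * x).
    transitivity (g%:R * (p%:R * a + b) * x); first by rewrite ab mulr1.
    by rewrite fE natrM; ring.
  have Iax : I (a * x) by exact: idealM.
  have Igx : I (g%:R * x) by exact: ideal_nat.
  rewrite xiD ?xib ?mulr1 //; last by apply: idealM.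
    by rewrite xi_nat //; apply/unity_rootP; exact: xi_unity.
  exact: ideal_nat.
rewrite f_gen /= dvdzE /= fE => /dvdn_leq.
have g0 : (0 < g)%N by move: f_gt0; rewrite fE muln_gt0 => /andP[].
by move=> /(_ g0); rewrite leqNgt ltn_Pmulr // prime_gt1.
Qed.

(** As p is invertible modulo f, the value at a is a power of the value at p a. This keeps 1 - z
    away from 0. *)
Lemma xi_p_neq1 a : I a -> xi a <> 1 -> xi (p%:R * a) != 1.
Proof.
move=> Ia xa; apply/eqP; rewrite xi_nat // => xp; apply: xa.
have /unity_rootP xf := xi_unity Ia.
have /(coprimeP f (prime_gt0 p_prime))[[u v] /= E] := coprime_p_f.
have {}E : (u * p = 1 + v * f)%N by lia.
have := congr1 (fun n => xi a ^+ n) E.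
by rewrite mulnC exprM xp expr1n exprD expr1 mulnC exprM xf expr1n mulr1 => <-.
Qed.

Local Notation t1 := (p%:R * tau1).
Local Notation t2 := (p%:R * tau2).

Let scale_nat (n : nat) x : n%:R * x = (n%:R : rat) *: x.
Proof. by rewrite mulr_natl scaler_nat. Qed.

Let lin_pt (l m : rat) : l *: t1 + m *: t2 = (l * p%:R) *: tau1 + (m * p%:R) *: tau2.
Proof. by rewrite !scale_nat !scalerA. Qed.

Let It1p : I t1. Proof. exact: ideal_nat. Qed.
Let It2p : I t2. Proof. exact: ideal_nat. Qed.

Let F : set k := prime_to p I `&` parallelogram t1 t2.

(** The coordinates of a point with respect to tau1 and tau2 lie in [0, p] and have denominator
    dividing D. *)
Lemma finite_parallelogram : finite_set F.
Proof.
have [D D0 hD] := ideal_lattice k_quadratic iota_neq I_frac It1 It2 tau_free.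
(* The successor is needed because the numerator can reach |D| p, at l = 1. *)
pose n := (`|D| * p).+1%N.
pose h (ij : 'I_n * 'I_n) : k :=
  ((ij.1%:R / `|D|%N%:R) : rat) *: tau1 + ((ij.2%:R / `|D|%N%:R) : rat) *: tau2.
apply: (@sub_finite_set _ _ (h @` setT)); last exact/finite_image/finite_finset.
move=> x [[Ix _] [l [m [/andP[l0 l1] /andP[m0 m1] xE]]]].
have [i [j E]] := hD x Ix.
have intE (z : int) y : z%:~R * y = (z%:~R : rat) *: y.
  by rewrite -[RHS]mulr_algl alg_num_field ratr_int.
have [li mj] : D%:~R * (l * p%:R) = i%:~R :> rat /\ D%:~R * (m * p%:R) = j%:~R :> rat.
  apply: (free2_inj tau_free).
  rewrite -[(_ * (l * _)) *: _]scalerA -[(_ * (m * _)) *: _]scalerA.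
  by rewrite -scalerDr -lin_pt -xE -!intE.
have DQ : 0 < `|D|%N%:R :> rat by rewrite ltr0n absz_gt0.
have key (q : rat) (i' : int) : 0 <= q -> q <= 1 -> D%:~R * (q * p%:R) = i'%:~R ->
    exists b : 'I_n, q * p%:R = b%:R / `|D|%N%:R.
  move=> q0 q1 qE; have qp0 : 0 <= q * p%:R by rewrite mulr_ge0 // ltW.
  have E' : `|D|%N%:R * (q * p%:R) = `|i'|%N%:R.
    by rewrite !natr_absz !intr_norm -qE normrM (ger0_norm qp0).
  have bnd : (`|i'| < n)%N.
    rewrite ltnS -(@ler_nat rat) natrM -E' ler_pM2l //.
    by rewrite -[leRHS]mul1r ler_wpM2r // ltW.
  by exists (Ordinal bnd); rewrite /= -E' [RHS]mulrC mulKf // lt0r_neq0.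
have [a aE] := key l i (ltW l0) l1 li; have [b bE] := key m j m0 (ltW m1) mj.
by exists (a, b) => //; rewrite /h -aE -bE xE lin_pt.
Qed.

Let rF : seq k := fset_set F.

Let rFP x : (x \in rF) = (x \in F).
Proof. by rewrite in_fset_set //; exact: finite_parallelogram. Qed.

Let Phi x (ij : nat * nat) : k := x + ij.1%:R * t1 + ij.2%:R * t2.

Let cone_neq0 x : cone tau1 tau2 x -> x != 0.
Proof.
move=> [l [m [l0 m0 ->]]]; apply/eqP => E.
have E0 : l *: tau1 + m *: tau2 = 0 *: tau1 + 0 *: tau2 by rewrite E !scale0r addr0.
have [lz _] := free2_inj tau_free E0.
by rewrite lz ltxx in l0.
Qed.

Let par_cone x l m : 0 < l -> 0 <= m -> x = l *: t1 + m *: t2 -> cone tau1 tau2 x.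
Proof.
move=> l0 m0 ->; exists (l * p%:R), (m * p%:R).
split; [exact: mulr_gt0|by rewrite mulr_ge0 // ltW|exact: lin_pt].
Qed.

Let PhiE l m (i j : nat) :
  Phi (l *: t1 + m *: t2) (i, j) = (l + i%:R) *: t1 + (m + j%:R) *: t2.
Proof. by rewrite /Phi /= !scale_nat !scalerDl; rewrite -!addrA; congr (_ + _); rewrite addrCA. Qed.

Let shiftE x (i j : nat) : Phi x (i, j) = x + p%:R * (i%:R * tau1 + j%:R * tau2).
Proof. by rewrite /Phi /=; ring. Qed.

(** The index condition passes along a translation by an element of pI; [prime_to_shift] needs
    nonzero points, and the cone avoids 0. *)
Lemma Phi_domain x ij : F x -> zTp_domain p I tau1 tau2 (Phi x ij).
Proof.
case: ij => i j [px [l [m [/andP[l0 l1] /andP[m0 m1] xE]]]].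
have Pcone : cone tau1 tau2 (Phi x (i, j)).
  apply: (par_cone (l := l + i%:R) (m := m + j%:R)).
  - by rewrite ltr_wpDr.
  - by rewrite addr_ge0.
  - by rewrite xE PhiE.
split=> //; have := cone_neq0 Pcone; rewrite shiftE => nz.
apply: (prime_to_shift k_quadratic iota_neq I_frac It1 It2 tau_free p_prime) => //.
  by apply: (idealD I_frac); exact: ideal_nat.
by apply: cone_neq0; exact: par_cone xE.
Qed.

Let nat_part (q : rat) : 0 <= q -> exists n : nat, 0 <= q - n%:R < 1.
Proof.
move=> q0; have /andP[h1 h2] := Num.Theory.truncn_itv q0.
exists (Num.Def.trunc q); rewrite subr_ge0 h1 ltrBlDr addrC natr1; exact: h2.
Qed.

(** The interval is open at 0 and closed at 1, as in [parallelogram]: an integral q leaves the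
    remainder 1 instead of 0. *)
Let nat_part_pos (q : rat) : 0 < q -> exists n : nat, 0 < q - n%:R <= 1.
Proof.
move=> q0; have [n /andP[n0 n1]] := nat_part (ltW q0).
have [q_n|qn] := eqVneq (q - n%:R) 0; last by exists n; rewrite lt_neqAle eq_sym qn n0 ltW.
case: n => [|n] in n0 n1 q_n *; first by rewrite subr0 in q_n; rewrite q_n ltxx in q0.
exists n; have -> : q - n%:R = q - n.+1%:R + 1 by rewrite -natr1; ring.
by rewrite q_n add0r ltr01 lexx.
Qed.

(** The integer parts of the coordinates with respect to p tau1 and p tau2 are removed; the
    representative differs from a by an element of pI. *)
Lemma domain_Phi a : zTp_domain p I tau1 tau2 a -> exists2 x, F x & exists ij, Phi x ij = a.
Proof.
move=> [pa [l [m [l0 m0 aE]]]].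
have [i i01] : exists i : nat, 0 < l / p%:R - i%:R <= 1 by apply: nat_part_pos; rewrite divr_gt0.
have [j j01] : exists j : nat, 0 <= m / p%:R - j%:R < 1 by apply: nat_part; rewrite divr_ge0 // ltW.
pose x := (l / p%:R - i%:R) *: t1 + (m / p%:R - j%:R) *: t2.
have xa : Phi x (i, j) = a.
  by rewrite PhiE !subrK lin_pt !divfK.
have xE : x = a + p%:R * (- (i%:R * tau1 + j%:R * tau2)).
  by rewrite -xa shiftE; ring.
have cx : cone tau1 tau2 x.
  by apply: (par_cone (l := l / p%:R - i%:R) (m := m / p%:R - j%:R)) => //;
    [case/andP: i01|case/andP: j01].
exists x; last by exists (i, j).
split; last by exists (l / p%:R - i%:R), (m / p%:R - j%:R).
have a0 : a != 0 by apply: cone_neq0; exists l, m.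
have := cone_neq0 cx; rewrite xE => nz.
apply: (prime_to_shift k_quadratic iota_neq I_frac It1 It2 tau_free p_prime) => //.
rewrite -[- _]add0r; apply: (idealB I_frac) => //.
by apply: (idealD I_frac); exact: ideal_nat.
Qed.

Lemma Phi_inj x y ij ij' : F x -> F y -> Phi x ij = Phi y ij' -> x = y /\ ij = ij'.
Proof.
move=> [_ [l [m [/andP[l0 l1] /andP[m0 m1] ->]]]] [_ [l' [m' [/andP[l0' l1'] /andP[m0' m1'] ->]]]].
case: ij ij' => i j [i' j']; rewrite !PhiE !lin_pt.
move=> /(free2_inj tau_free)[/(mulIf p0) E1 /(mulIf p0) E2].
have ii : i = i'.
  apply/eqP; rewrite eqn_leq; apply/andP; split; rewrite -ltnS -(@ltr_nat rat) -natr1; lra.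
have jj : j = j'.
  apply/eqP; rewrite eqn_leq; apply/andP; split; rewrite -ltnS -(@ltr_nat rat) -natr1; lra.
by rewrite ii jj in E1 E2 *; rewrite (addIr _ E1) (addIr _ E2).
Qed.

Let cone_pos (iota : {rmorphism k -> R}) x : 0 < iota tau1 -> 0 < iota tau2 ->
  cone tau1 tau2 x -> 0 < iota x.
Proof.
move=> i1 i2 [l [m [l0 m0 ->]]]; rewrite rmorphD !iota_scale.
by apply: ltr_wpDr; [rewrite mulr_ge0 ?ler0q // ltW|rewrite mulr_gt0 ?ltr0q].
Qed.

Let F_cone x : F x -> cone tau1 tau2 x.
Proof.
by move=> [_ [l [m [/andP[l0 _] /andP[m0 _] xE]]]]; exact: par_cone xE.
Qed.

Let F_I x : F x -> I x. Proof. by case=> -[]. Qed.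

Let t_pos (iota : {rmorphism k -> R}) t : 0 < iota t -> 0 < iota (p%:R * t).
Proof. by move=> it; rewrite rmorphM rmorph_nat mulr_gt0. Qed.

Let term s x (ij : nat * nat) : R[i] := cone_term (iota1 x) (iota2 x) (iota1 t1) (iota2 t1)
  (iota1 t2) (iota2 t2) s ij.1 ij.2.

Let zTp_term_Phi s x ij : F x -> zTp_term iota1 iota2 xi s (Phi x ij) =
  xi x * (xi t1 ^+ ij.1 * xi t2 ^+ ij.2 * term s x ij).
Proof.
case: ij => i j Fx; have Ix := F_I Fx.
have [_ Pc] := Phi_domain (i, j) Fx.
have p1 : 0 < iota1 (Phi x (i, j)) by exact: cone_pos Pc.
have p2 : 0 < iota2 (Phi x (i, j)) by exact: cone_pos Pc.
set A := iota1 _ in p1; set B := iota2 _ in p2.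
have AE : A = iota1 x + i%:R * iota1 t1 + j%:R * iota1 t2.
  by rewrite /A /Phi !rmorphD !rmorphM !rmorph_nat.
have BE : B = iota2 x + i%:R * iota2 t1 + j%:R * iota2 t2.
  by rewrite /B /Phi !rmorphD !rmorphM !rmorph_nat.
rewrite /zTp_term /cpow -/A -/B -cexpN.
have -> : - (s * (ln (A * B))%:C) = - s * (ln A)%:C + - s * (ln B)%:C.
  by rewrite lnM ?posrE //; rewrite [(_ + _)%:C]rmorphD; ring.
have -> : xi (Phi x (i, j)) = xi x * xi t1 ^+ i * xi t2 ^+ j.
  rewrite /Phi /= xiD ?xiD ?xi_nat //; try exact: ideal_nat.
  by apply: (idealD I_frac) => //; exact: ideal_nat.
by rewrite /term /cone_term /logpow /= expr0 mulr1 !mulrA -AE -BE.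
Qed.

Let ind s a : R[i] := if a \in zTp_domain p I tau1 tau2 then zTp_term iota1 iota2 xi s a else 0.
(** The summand restricted to one translate and extended by zero: the domain is the disjoint union
    of these translates, so the sum over it splits without any rearrangement argument. *)
Let piece s x a : R[i] :=
  if pselect (exists ij, Phi x ij = a) then zTp_term iota1 iota2 xi s a else 0.

Let indE s : ind s = fun a => \sum_(x <- rF) piece s x a.
Proof.
apply/funext => a; rewrite /ind; case: ifPn => [/set_mem aD|aD].
  have [x Fx xa] := domain_Phi aD.
  have xr : x \in rF by rewrite rFP mem_set.
  rewrite (bigD1_seq x) ?fset_uniq //= {1}/piece; case: pselect => //= _.
  rewrite big_seq_cond big1 ?addr0 // => y /andP[yr yx]; rewrite /piece.
  case: pselect => //= -[ij' ya]; have [ij xa'] := xa.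
  have [yx' _] : y = x /\ ij' = ij.
    by apply: Phi_inj => //; [apply: set_mem; rewrite -rFP|rewrite ya].
  by rewrite yx' eqxx in yx.
rewrite big_seq big1 // => x xr; rewrite /piece; case: pselect => //= -[ij xa].
by case/negP: aD; rewrite mem_set // -xa; apply: Phi_domain; apply: set_mem; rewrite -rFP.
Qed.

Let piece_Phi s x ij : F x -> piece s x (Phi x ij) =
  xi x * (xi t1 ^+ ij.1 * xi t2 ^+ ij.2 * term s x ij).
Proof.
move=> Fx; rewrite /piece; case: pselect => [_|[]] /=; last by exists ij.
exact: zTp_term_Phi.
Qed.

Let piece0 s x a : (forall ij, Phi x ij <> a) -> piece s x a = 0.
Proof. by move=> na; rewrite /piece; case: pselect => //= -[ij /na]. Qed.

Let Phi_injective x : F x -> injective (Phi x).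
Proof. by move=> Fx ij ij' /(Phi_inj Fx Fx)[]. Qed.

Let summ_term s x : 1 < complex.Re s -> F x -> abs_summ (term s x).
Proof.
move=> s1 Fx; have cx := F_cone Fx.
by apply: abs_summ_cone_term => //; try exact: t_pos; exact: cone_pos cx.
Qed.

Let summ_twisted s x : 1 < complex.Re s -> F x ->
  abs_summ (fun ij => xi t1 ^+ ij.1 * xi t2 ^+ ij.2 * term s x ij).
Proof.
move=> s1 Fx; have := summ_term s1 Fx; apply: (abs_summ_twist2 (phi := fun i j => term s x (i, j)));
  by rewrite modulus_xi.
Qed.

Lemma zTp_summable s : 1 < complex.Re s ->
  abs_summable (zTp_domain p I tau1 tau2) (zTp_term iota1 iota2 xi s).
Proof.
move=> s1; apply: abs_summ_summable; rewrite -/(ind s) indE.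
apply: abs_summ_bigfam => x; rewrite rFP => /set_mem Fx.
apply: (abs_summ_image (Phi_injective Fx)); first exact: piece0.
apply: (abs_summ_le (c := 1)) (abs_summZ (xi x) (summ_twisted s1 Fx)) => ij.
by rewrite mul1r /= piece_Phi.
Qed.

Definition shintani_zeta s : R[i] := \sum_(x <- rF) xi x *
  cone_zeta (iota1 x) (iota2 x) (iota1 t1) (iota2 t1) (iota1 t2) (iota2 t2)
    (xi t1) (xi t2) s.

Hypotheses (xi_tau1 : xi tau1 <> 1) (xi_tau2 : xi tau2 <> 1).

Lemma zTp_shintani_zeta s : 1 < complex.Re s ->
  zTp iota1 iota2 p xi I tau1 tau2 s = shintani_zeta s.
Proof.
move=> s1; apply: csum_has_sum; rewrite -/(ind s) indE.
apply: has_sum_bigfam => x; rewrite rFP => /set_mem Fx.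
apply: (has_sum_image (Phi_injective Fx)); first exact: piece0.
rewrite cone_zeta_sum ?modulus_xi ?xi_p_neq1 //; try exact: t_pos;
  try exact: cone_pos (F_cone Fx).
apply: has_sum_ext (has_sumZ (xi x) (tsumP (summ_twisted s1 Fx))) => ij.
by rewrite /= piece_Phi.
Qed.

Lemma shintani_zeta_cdiff s : cdiff shintani_zeta s.
Proof.
apply: (@cdiff_sum _ _ _ (fun x z => xi x *
  cone_zeta (iota1 x) (iota2 x) (iota1 t1) (iota2 t1) (iota1 t2) (iota2 t2)
    (xi t1) (xi t2) z)) => x; rewrite rFP => /set_mem Fx.
apply: cdiffZ; apply: cone_zeta_cdiff; rewrite ?modulus_xi ?xi_p_neq1 //; try exact: t_pos;
  exact: cone_pos (F_cone Fx).
Qed.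

Let np (i1 i2 : {rmorphism k -> R}) m x := norm_pow m (i1 t1)%:C (i2 t1)%:C (i1 t2)%:C (i2 t2)%:C
  (i1 x)%:C (i2 x)%:C.

(** The finite expression to which both the value of the continuation and Delta^m of F at 0 are
    reduced. *)
Let value K (c : k -> nat -> nat -> R[i]) := \sum_(x <- rF) xi x *
  \sum_(j < K) xi t1 ^+ j / (1 - xi t1) ^+ j.+1 *
    \sum_(l < K) xi t2 ^+ l / (1 - xi t2) ^+ l.+1 *
      iter l (@fdiff R[i]) (iter j (@fdiff1 R[i]) (c x) 0%N) 0%N.

Lemma shintani_zeta_nonpos (m : nat) : exists2 K, (m.*2.+1 <= K)%N &
  shintani_zeta (- m%:R) = value K (np iota1 iota2 m).
Proof.
exists (maxn (@cone_order R (- m%:R)) m.*2.+1); first exact: leq_maxr.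
rewrite /shintani_zeta /value big_seq [RHS]big_seq; apply: eq_bigr => x.
rewrite rFP => /set_mem Fx; congr (_ * _).
apply: cone_zeta_nonpos; rewrite ?modulus_xi ?xi_p_neq1 ?leq_maxl ?leq_maxr //; try exact: t_pos;
  exact: cone_pos (F_cone Fx).
Qed.

Lemma FTp_value (i1 i2 : {rmorphism k -> R}) (m K : nat) : (m.*2.+1 <= K)%N ->
  iter m (@ps_Delta _) (FTp i1 i2 p xi I tau1 tau2) 0%N 0%N = value K (np i1 i2 m).
Proof.
move=> mK; apply: (@Delta0_ps_div _ m _ _ _ _ _ rF xi (fun x => (i1 x)%:C) (fun x => (i2 x)%:C)).
- exact: xi_p_neq1.
- exact: xi_p_neq1.
- exact: mK.
by move=> i j; rewrite fsbig_finite //; exact: finite_parallelogram.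
Qed.

Let npC i1 i2 m x : np i2 i1 m x = np i1 i2 m x.
Proof.
by apply/funext => i; apply/funext => j; rewrite /np /norm_pow mulrC.
Qed.

(** The norms of the points [Phi x (i, j)] are rational, hence so are the powers and differences;
    everything else is a rational function of f-th roots of unity. *)
Lemma value_cyclotomic K m : cyclotomic_field f (value K (np iota1 iota2 m)).
Proof.
move=> S clS Sroot.
pose S' : divringClosed R[i] := HB.pack S (GRing.isDivringClosed.Build R[i] S clS).
have xiS a : I a -> xi a \in S' by move=> Ia; apply: Sroot; exact: xi_unity.
have npS x i j : np iota1 iota2 m x i j \in S'.
  rewrite /np /norm_pow; apply: rpredX.
  have -> : ((iota1 x)%:C + i%:R * (iota1 t1)%:C + j%:R * (iota1 t2)%:C) *
      ((iota2 x)%:C + i%:R * (iota2 t1)%:C + j%:R * (iota2 t2)%:C) =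
      (iota1 (Phi x (i, j)) * iota2 (Phi x (i, j)))%:C :> R[i].
    by rewrite /Phi /= !(rmorphD, rmorphM, rmorph_nat).
  have [_ [q [_ -> _]]] := trace_norm_rat k_quadratic iota_neq (Phi x (i, j)).
  by rewrite fmorph_rat; exact: rpred_rat.
have diffS x j l (n1 n2 : nat) :
    iter l (@fdiff R[i]) (iter j (@fdiff1 R[i]) (np iota1 iota2 m x) n1) n2 \in S'.
  elim: l n2 => [|l IHl] n2; last exact: rpredB (IHl n2.+1) (IHl n2).
  by elim: j n1 => [|j IHj] n1; [exact: npS|exact: rpredB (IHj n1.+1) (IHj n1)].
rewrite -[S]/(S' : {pred R[i]}) /value big_seq; apply: rpred_sum => x.
rewrite rFP => /set_mem Fx; apply: rpredM; first exact/xiS/F_I.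
apply: rpred_sum => j _; apply: rpredM.
  by apply: rpred_div; rewrite rpredX ?rpredB ?rpred1 // xiS.
apply: rpred_sum => l _; apply: rpredM; last exact: diffS.
by apply: rpred_div; rewrite rpredX ?rpredB ?rpred1 // xiS.
Qed.

Lemma shintani_zeta_value (m : nat) :
  [/\ shintani_zeta (- m%:R) = iter m (@ps_Delta _) (FTp iota1 iota2 p xi I tau1 tau2) 0%N 0%N,
      shintani_zeta (- m%:R) = iter m (@ps_Delta _) (FTp iota2 iota1 p xi I tau1 tau2) 0%N 0%N &
      cyclotomic_field f (shintani_zeta (- m%:R))].
Proof.
have [K mK ->] := shintani_zeta_nonpos m.
split; last exact: value_cyclotomic.
  exact: esym (FTp_value iota1 iota2 mK).
(* Exchanging the embeddings only exchanges the two factors of each norm. *)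
transitivity (value K (np iota2 iota1 m)); last exact: esym (FTp_value iota2 iota1 mK).
by congr value; apply/funext => x; rewrite npC.
Qed.

End ShintaniCone.
Theorem theorem3p2 (R : realType)
  (k : fieldExtType rat) (k_quadratic : \dim {:k}%VS = 2%N)
  (iota1 iota2 : {rmorphism k -> R}) (iota_neq : exists x, iota1 x <> iota2 x)
  (I : set k) (I_frac : fractional_ideal I)
  (xi : k -> R[i]) (xi_char : additive_character xi I)
  (ann_proper : annihilator xi I <> @integers k)
  (f : nat) (f_gt0 : (0 < f)%N)
  (f_gen : [set n : int | annihilator xi I n%:~R] = [set n | (f%:Z %| n)%Z])
  (tau1 tau2 : k) (tau_I : I tau1 /\ I tau2)
  (tau_free : free [:: tau1; tau2])
  (tau1_pos : 0 < iota1 tau1 /\ 0 < iota2 tau1)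
  (tau2_pos : 0 < iota1 tau2 /\ 0 < iota2 tau2)
  (xi_tau : xi tau1 <> 1 /\ xi tau2 <> 1)
  (p : nat) (p_prime : prime p)
  (p_coprime : coprime_ideal p (annihilator xi I)) :
  (forall s : R[i], 1 < complex.Re s ->
     abs_summable (zTp_domain p I tau1 tau2) (zTp_term iota1 iota2 xi s)) /\
  exists Z : R[i] -> R[i],
    meromorphic_continuation (zTp iota1 iota2 p xi I tau1 tau2) Z /\
    forall m : int, m <= 0 ->
      [/\ analytic_at Z m%:~R,
          Z m%:~R =
            iter `|m|%N (@ps_Delta _) (FTp iota1 iota2 p xi I tau1 tau2) 0%N 0%N,
          Z m%:~R =
            iter `|m|%N (@ps_Delta _) (FTp iota2 iota1 p xi I tau1 tau2) 0%N 0%N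
        & cyclotomic_field f (Z m%:~R)].
Proof.
case: tau_I tau1_pos tau2_pos xi_tau => It1 It2 [p11 p12] [p21 p22] [x1 x2].
split; first by move=> s s1; exact: zTp_summable.
exists (@shintani_zeta R k iota1 iota2 I xi tau1 tau2 p).
have an s : analytic_at (@shintani_zeta R k iota1 iota2 I xi tau1 tau2 p) s.
  by apply: cdiff_analytic => w; apply: (@shintani_zeta_cdiff _ _ _ _ _ _ _ _ _ _ f).
split; first split.
- by move=> w; left.
- by move=> s s1; apply/esym/(@zTp_shintani_zeta _ _ _ _ _ _ _ _ _ _ f).
move=> m m0; have -> : m%:~R = - `|m|%N%:R :> R[i].
  by rewrite pmulrn abszE ler0_norm // rmorphN opprK.
have [v1 v2 v3] : [/\ _, _ & _] := @shintani_zeta_value _ _ k_quadratic _ _ iota_neq _ _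
  I_frac xi_char _ f_gt0 f_gen _ _ It1 It2 tau_free
  p11 p12 p21 p22 _ p_prime p_coprime x1 x2 `|m|%N.
by split.
Qed.
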